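(* Let $X$ and $Y$ be two real (or complex) Riemannian manifolds of real dimensions $m$ and $n$ respectively, $m\ge n$, let $V\subset X\times Y$ be a solution variety with $\dim V=\dim X$, let $\Sigma\subset V$ be the set of critical points of the projection $\pi_1:V\to X$, let $(x,y)\in V\setminus\Sigma$, and let $DG(x):T_xX\to T_yY$ be the condition matrix at $(x,y)$, with singular values $\sigma_1,\ldots,\sigma_n$. Then for every $p=1,2,\ldots$, the $p$th-average condition number satisfies $$ \kappa_{av}^{[p]}(x,y)=\frac{1}{\sqrt 2}\left[\frac{\Gamma\left(\frac{m}{2}\right)}{\Gamma\left(\frac{m+p}{2}\right)}\right]^{1/p}\,\mathbb{E}\left(\|\eta_{\sigma_1,\ldots,\sigma_n}\|^p\right)^{1/p}, $$ where $\|\cdot\|$ is the Euclidean norm in $\mathbb{R}^n$ and $\eta_{\sigma_1,\ldots,\sigma_n}$ is a centered Gaussian vector in $\mathbb{R}^n$ with diagonal covariance matrix $\mathrm{Diag}(\sigma_1^2,\ldots,\sigma_n^2)$. In particular, for $p=2$, writing $\kappa_{av}:=\kappa_{av}^{[2]}$, $$ \kappa_{av}(x,y)=\frac{\kappa_F(x,y)}{\sqrt m}. $$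
   Context: Setting: $X$ (inputs) and $Y$ (outputs) are as in the claim, and $V\subset X\times Y$ (the solution variety, the set of pairs $(x,y)$ such that $y$ is an output for the input $x$) is a smooth submanifold with $\dim V=\dim X$. $\pi_1:V\to X$ and $\pi_2:V\to Y$ are the canonical projections, and $\Sigma\subset V$ is the set of critical points of $\pi_1$. For $(x,y)\in V\setminus\Sigma$, $\pi_1$ is a local diffeomorphism at $(x,y)$, so there are neighborhoods $U_x$ of $x$ and $U_y$ of $y$ and a differentiable map $G:=\pi_2\circ\pi_1^{-1}|_{U_x}:U_x\to U_y$ (using the local inverse of $\pi_1$ through $(x,y)$), with $G(x)=y$. The derivative $DG(x):T_xX\to T_yY$ is called the condition matrix at $(x,y)$. In the complex case all tangent spaces and the condition matrix are regarded as real (a complex matrix is identified with the associated real matrix of twice the size). The norms $\|\cdot\|_x$ and $\|\cdot\|_y$ on $T_xX$ and $T_yY$ come from the Riemannian inner products, and singular values are with respect to these inner products; $DG(x)$ has $n$ singular values $\sigma_1,\ldots,\sigma_n\ge 0$ (some may be zero, in which case the Gaussian vector is degenerate). The $p$th-average condition number is $$\kappa_{av}^{[p]}(x,y):=\left[\frac{1}{\mathrm{vol}(S_x^{m-1})}\int_{\dot x\in S_x^{m-1}}\|DG(x)\dot x\|_y^p\,dS_x^{m-1}(\dot x)\right]^{1/p},$$ where $S_x^{m-1}$ is the unit sphere of $T_xX$, $dS_x^{m-1}$ its induced volume element, and $\mathrm{vol}(S_x^{m-1})=\frac{2\pi^{m/2}}{\Gamma(m/2)}$ its measure. The Frobenius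 condition number is $\kappa_F(x,y):=\|DG(x)\|_F=\sqrt{\sigma_1^2+\cdots+\sigma_n^2}$, where $\|\cdot\|_F$ is the Frobenius norm. *)

(* Defs.v *)
From HB Require Import structures.
From mathcomp Require Import all_boot all_order all_algebra.
From mathcomp Require Import all_classical all_reals all_analysis.

Set Implicit Arguments.
Unset Strict Implicit.
Unset Printing Implicit Defensive.

Import Order.TTheory GRing.Theory Num.Theory.
Import numFieldNormedType.Exports.

Local Open Scope classical_set_scope.
Local Open Scope ring_scope.

(* Tangent vectors are row vectors of coordinates in a chart; a linear map with
   matrix M acts by v |-> v *m M, as in the library's ['J f p]. *)

Fixpoint Ck (R : realType) (V W : normedModType R) (k : nat) (U : set V)
    (f : V -> W) : Prop :=
  match k with
  | 0%N => forall u, U u -> {for u, continuous f}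
  | k'.+1 => (forall u, U u -> differentiable f u) /\
             (forall v : V, Ck k' U (fun u => 'D_v f u))
  end.

Definition smooth_on (R : realType) (V W : normedModType R) (U : set V)
    (f : V -> W) : Prop :=
  forall k, Ck k U f.

(* [cmap] and [cinv] are total functions, meaningful only on [cdom] and on
   [cimg]. *)
Record chart (R : realType) (M : Type) (d : nat) := Chart {
  cdom : set M ;
  cmap : M -> 'rV[R]_d ;
  cinv : 'rV[R]_d -> M }.

Definition cimg (R : realType) (M : Type) (d : nat) (c : chart R M d) :
  set 'rV[R]_d := cmap c @` cdom c.

Definition is_chart (R : realType) (M : topologicalType) (d : nat)
    (c : chart R M d) : Prop :=
  [/\ open (cdom c), open (cimg c),
      forall x, cdom c x -> cinv c (cmap c x) = x,
      forall x, cdom c x -> {for x, continuous (cmap c)} &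
      forall u, cimg c u -> {for u, continuous (cinv c)}].

Definition overlap (R : realType) (M : Type) (d : nat) (c c' : chart R M d) :
  set 'rV[R]_d := cmap c @` (cdom c `&` cdom c').

Definition transition (R : realType) (M : Type) (d : nat)
    (c c' : chart R M d) : 'rV[R]_d -> 'rV[R]_d :=
  fun u => cmap c' (cinv c u).

Definition smooth_compatible (R : realType) (M : Type) (d : nat)
    (c c' : chart R M d) : Prop :=
  smooth_on (overlap c c') (transition c c') /\
  smooth_on (overlap c' c) (transition c' c).

Definition smooth_atlas (R : realType) (M : topologicalType) (d : nat)
    (A : set (chart R M d)) : Prop :=
  [/\ forall c, A c -> is_chart c,
      forall x, exists2 c, A c & cdom c x &
      forall c c', A c -> A c' -> smooth_compatible c c'].

(* [rmetric x c] is the Gram matrix, in the coordinate basis of the chart c, of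
   the inner product on the tangent space at x. *)
Record riemannianManifold (R : realType) (d : nat) := RiemannianManifold {
  rpoint :> topologicalType ;
  r_hausdorff : hausdorff_space rpoint ;
  r_second_countable : @second_countable rpoint ;
  ratlas : set (chart R rpoint d) ;
  r_atlasP : smooth_atlas ratlas ;
  rmetric : rpoint -> chart R rpoint d -> 'M[R]_d ;
  r_metric_sym : forall x c, ratlas c -> cdom c x ->
    (rmetric x c)^T = rmetric x c ;
  r_metric_pos : forall x c, ratlas c -> cdom c x ->
    forall v : 'rV[R]_d, v != 0 -> 0 < (v *m rmetric x c *m v^T) 0 0 ;
  r_metric_smooth : forall c, ratlas c -> forall i j,
    smooth_on (cimg c) (fun u => rmetric (cinv c u) c i j : R^o) ;
  r_metric_change : forall x c c', ratlas c -> ratlas c' ->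
    cdom c x -> cdom c' x ->
    let J := 'J (transition c c') (cmap c x) in
    rmetric x c = J *m rmetric x c' *m J^T }.

Definition prod_chart (R : realType) (M N : Type) (m n : nat)
    (a : chart R M m) (b : chart R N n) : chart R (M * N)%type (m + n) :=
  Chart (cdom a `*` cdom b)
        (fun z => row_mx (cmap a z.1) (cmap b z.2))
        (fun u => (cinv a (lsubmx u), cinv b (rsubmx u))).

Definition prod_atlas (R : realType) (m n : nat)
    (X : riemannianManifold R m) (Y : riemannianManifold R n) :
    set (chart R (X * Y)%type (m + n)) :=
  [set c | exists a b, [/\ ratlas a, ratlas b & c = prod_chart a b]].

(* A chart of X * Y, smoothly compatible with its product structure, in which V
   is the slice where the last n coordinates vanish. *)
Definition slice_chart (R : realType) (m n : nat)
    (X : riemannianManifold R m) (Y : riemannianManifold R n)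
    (V : set (X * Y)) (c : chart R (X * Y)%type (m + n)) : Prop :=
  [/\ is_chart c,
      forall a, prod_atlas a -> smooth_compatible c a &
      forall z, cdom c z -> (V z <-> rsubmx (cmap c z) = 0)].

(* Smooth (embedded) submanifold of X * Y of dimension m = dim X. *)
Definition solution_variety (R : realType) (m n : nat)
    (X : riemannianManifold R m) (Y : riemannianManifold R n)
    (V : set (X * Y)) : Prop :=
  forall z, V z -> exists2 c, slice_chart V c & cdom c z.

(* The first m coordinates of a slice chart c are local coordinates on V; in
   these and in a chart a of X, the first projection V -> X is the map whose
   Jacobian is taken below. *)
Definition critical_point (R : realType) (m n : nat)
    (X : riemannianManifold R m) (Y : riemannianManifold R n)
    (V : set (X * Y)) (z : X * Y) : Prop :=
  V z /\ exists c (a : chart R X m),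
    [/\ slice_chart V c, cdom c z, ratlas a, cdom a z.1 &
        ~~ row_full ('J (fun t : 'rV[R]_m => cmap a (cinv c (row_mx t 0)).1)
                        (lsubmx (cmap c z)))].

(* G : Ux -> Uy is the second projection composed with the local inverse of the
   first projection V -> X through (x, y): over Ux, the part of V with second
   component in Uy is the graph of G. *)
Definition local_solution_map (R : realType) (m n : nat)
    (X : riemannianManifold R m) (Y : riemannianManifold R n)
    (V : set (X * Y)) (x : X) (y : Y) (G : X -> Y) : Prop :=
  exists (Ux : set X) (Uy : set Y),
    [/\ open_nbhs x Ux, open_nbhs y Uy,
        forall x', Ux x' -> Uy (G x'),
        forall x' y', Ux x' -> Uy y' -> (V (x', y') <-> y' = G x') &
        forall (a : chart R X m) (b : chart R Y n) x',
          ratlas a -> ratlas b -> Ux x' -> cdom a x' -> cdom b (G x') ->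
          differentiable (fun u => cmap b (G (cinv a u))) (cmap a x')].

(* The condition matrix DG(x), in the coordinate bases of the charts a and b. *)
Definition condition_matrix (R : realType) (m n : nat)
    (X : riemannianManifold R m) (Y : riemannianManifold R n)
    (a : chart R X m) (b : chart R Y n) (G : X -> Y) (x : X) : 'M[R]_(m, n) :=
  'J (fun u => cmap b (G (cinv a u))) (cmap a x).

Definition gnorm (R : realType) (d : nat) (g : 'M[R]_d) (v : 'rV[R]_d) : R :=
  Num.sqrt ((v *m g *m v^T) 0 0).

(* Singular values sigma_j of M : (R^m, gX) -> (R^n, gY), n <= m, through the
   singular value decomposition: the rows of B and C are orthonormal bases, with
   B_j mapped to sigma_j C_j for j < n and to 0 for j >= n. *)
Definition singular_values (R : realType) (m n : nat) (gX : 'M[R]_m)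
    (gY : 'M[R]_n) (M : 'M[R]_(m, n)) (sigma : 'I_n -> R) : Prop :=
  (forall j, 0 <= sigma j) /\
  exists (B : 'M[R]_m) (C : 'M[R]_n),
    [/\ B *m gX *m B^T = 1%:M, C *m gY *m C^T = 1%:M &
        B *m M = (\matrix_(i < m, j < n)
                    (if (i == j :> nat) then sigma j else 0)) *m C].

(* (tr (L^* L))^(1/2), where L is the map with matrix M and L^* its adjoint with
   respect to the inner products gX and gY; L^* has matrix gY M^T gX^-1. *)
Definition frobenius_norm (R : realType) (m n : nat) (gX : 'M[R]_m)
    (gY : 'M[R]_n) (M : 'M[R]_(m, n)) : R :=
  Num.sqrt (\tr (M *m (gY *m M^T *m invmx gX))).

(* Borel sigma-algebra of R^k *)
Definition borelV (R : realType) (k : nat) :=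
  g_sigma_algebraType (@open 'rV[R]_k).

(* Lebesgue integral over R^k of a nonnegative Borel function, as an iterated
   integral (Tonelli); R^0 is a point of measure 1. *)
Fixpoint integral_rV (R : realType) (k : nat) :
    ('rV[R]_k -> \bar R) -> \bar R :=
  match k return ('rV[R]_k -> \bar R) -> \bar R with
  | 0%N => fun f => f 0
  | k'.+1 => fun f =>
      (\int[@lebesgue_measure R]_t
         integral_rV (fun u : 'rV[R]_k' => f (row_mx (const_mx t : 'rV[R]_1) u)))%E
  end.

(* mu is the volume measure that the inner product g of R^d induces on the
   k-dimensional submanifold S: in every C^1 parametrization phi of an open piece
   of S, its density is the square root of the Gram determinant of d(phi). *)
Definition induced_volume (R : realType) (k d : nat) (g : 'M[R]_d)
    (S : set 'rV[R]_d) (mu : set (borelV R d) -> \bar R) : Prop :=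
  mu (~` S) = 0%E /\
  forall (U : set 'rV[R]_k) (phi : 'rV[R]_k -> 'rV[R]_d),
    open U -> Ck 1 U phi -> {in U &, injective phi} ->
    (forall u, U u -> row_free ('J phi u)) -> phi @` U `<=` S ->
    forall B : set (borelV R d), measurable B -> B `<=` phi @` U ->
      mu B = integral_rV (fun u =>
        (\1_(U `&` phi @^-1` B) u *
         Num.sqrt (\det ('J phi u *m g *m ('J phi u)^T)))%:E).

Definition unit_sphere (R : realType) (d : nat) (g : 'M[R]_d) :
  set 'rV[R]_d := [set v | gnorm g v = 1].

(* S_x^(m-1), the unit sphere of the tangent space at x in the coordinates of a *)
Definition tangent_sphere (R : realType) (m : nat) (X : riemannianManifold R m)
    (a : chart R X m) (x : X) : set 'rV[R]_m :=
  unit_sphere (rmetric x a).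

Definition kappa_av (R : realType) (m n : nat)
    (X : riemannianManifold R m) (Y : riemannianManifold R n)
    (a : chart R X m) (b : chart R Y n) (G : X -> Y) (x : X) (y : Y)
    (dS : {measure set (borelV R m) -> \bar R}) (p : nat) : \bar R :=
  let S := tangent_sphere a x in
  ((((fine (dS S))^-1)%:E *
    \int[dS]_(v in S)
      (gnorm (rmetric y b) (v *m condition_matrix a b G x) ^+ p)%:E)
   `^ (p%:R^-1))%E.

Definition kappa_F (R : realType) (m n : nat)
    (X : riemannianManifold R m) (Y : riemannianManifold R n)
    (a : chart R X m) (b : chart R Y n) (G : X -> Y) (x : X) (y : Y) : R :=
  frobenius_norm (rmetric x a) (rmetric y b) (condition_matrix a b G x).

Definition Gamma (R : realType) (s : R) : R :=
  fine (\int[@lebesgue_measure R]_(t in `]0%R, +oo[)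
          (t `^ (s - 1) * expR (- t))%:E)%E.

Definition independent_RVs (R : realType) (d : measure_display)
    (T : measurableType d) (P : probability T R) (k : nat)
    (Z : 'I_k -> {RV P >-> R}) : Prop :=
  forall (J : {set 'I_k}) (B : 'I_k -> set R), (forall i, measurable (B i)) ->
    P (\bigcap_(i in [set` J]) (Z i @^-1` B i)) =
    (\prod_(i in J) P (Z i @^-1` B i))%E.

(* A Gaussian vector, possibly degenerate, is an affine image of a vector of
   independent standard normal variables. *)
Definition gaussian_vector (R : realType) (d : measure_display)
    (T : measurableType d) (P : probability T R) (n : nat)
    (eta : 'I_n -> {RV P >-> R}) : Prop :=
  exists (k : nat) (Z : 'I_k -> {RV P >-> R}) (A : 'M[R]_(n, k))
         (c : 'I_n -> R),
    [/\ independent_RVs Z,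
        forall j (B : set R), measurable B ->
          distribution P (Z j) B = normal_prob 0 1 B &
        {ae P, forall w, forall i,
           eta i w = \sum_(j < k) A i j * Z j w + c i}].

Definition centered_gaussian_diag (R : realType) (d : measure_display)
    (T : measurableType d) (P : probability T R) (n : nat)
    (eta : 'I_n -> {RV P >-> R}) (sigma : 'I_n -> R) : Prop :=
  [/\ gaussian_vector eta,
      forall i, ('E_P[eta i] = 0)%E &
      forall i j, covariance P (eta i) (eta j) =
                  (if i == j then sigma i ^+ 2 else 0)%:E].

Definition enorm (R : realType) (n : nat) (v : 'I_n -> R) : R :=
  Num.sqrt (\sum_(i < n) v i ^+ 2).

(* Main.v *)
(* A frame of singular vectors carries the volume of the unit sphere of [T_x X]
   to a measure [mu] on the Euclidean unit sphere and turns [||DG v||] into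
   [(\sum_j (x_j sigma_j)^2)^(1/2)].  Comparing two stereographic charts in
   different frames, [mu] is finite, nonzero and rotation invariant, so that
   [\int |<x, a>|^p dmu(x) = c |a|^p] with [c] independent of [a].  For fixed [x],
   [<x, eta>] is a centered normal variable of standard deviation
   [(\sum_j (x_j sigma_j)^2)^(1/2)].  Integrating [|<x, eta>|^p] in both orders
   thus relates the spherical average to [E ||eta||^p] by a factor that depends
   only on [m], [p] and [mu]; the case of a standard normal vector of [R^m], whose
   squared norm has a chi-square law, identifies this factor. *)

From HB Require Import structures.
From mathcomp Require Import all_boot all_order all_algebra.
From mathcomp Require Import all_classical all_reals all_analysis.
From mathcomp Require Import measurable_realfun ring lra.
(* Imported last: [gnorm] is also a constant of [mathcomp.boot.monoid]. *)
Require Import Defs.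
Set Implicit Arguments.
Unset Strict Implicit.
Unset Printing Implicit Defensive.
Import Order.TTheory GRing.Theory Num.Theory.
Import numFieldNormedType.Exports.
Local Open Scope classical_set_scope.
Local Open Scope ring_scope.

(** [dS] is given only by its values on images of parametrizations and off the sphere, so each of
    its properties has to be read off charts. In stereographic coordinates written in an orthonormal
    frame, the density is a power of the conformal factor and does not see the frame. Frames that
    differ by an orthogonal matrix thus give the same measure, and this is the rotation invariance.
    The mass of the sphere is never computed: it is finite and positive, and it cancels once a
    standard normal vector of [R^m] is inserted, because the norm of [x] is 1 on the whole sphere.

    Singular values may vanish, so laws are expressed by integrals of nonnegative functions against
    a scaled standard normal rather than by densities. Passing from the definition of a Gaussian
    vector to the law of each of its linear forms rests on the rotation invariance of the normal
    density of the plane. The Gamma function is treated by probability too: total mass one makes its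
    values at half-integers finite and positive, and the second moment of a standard vector gives
    the ratio used for [p = 2]. *)

Definition image_measure d1 d2 (T1 : measurableType d1) (T2 : measurableType d2)
    (R : realType) (m : {measure set T1 -> \bar R}) (f : T1 -> T2)
    (mf : measurable_fun setT f) : {measure set T2 -> \bar R}.
Proof.
pose p : {measure set T2 -> \bar R} := pushforward m f.
exact (p mf).
Defined.

Lemma image_measureE d1 d2 (T1 : measurableType d1) (T2 : measurableType d2)
    (R : realType) (m : {measure set T1 -> \bar R}) (f : T1 -> T2)
    (mf : measurable_fun setT f) A : image_measure m mf A = m (f @^-1` A).
Proof. by []. Qed.

Lemma ge0_integral_image_measure d1 d2 (T1 : measurableType d1)
    (T2 : measurableType d2)  (R : realType) (m : {measure set T1 -> \bar R})
   (f : T1 -> T2) (mf : measurable_fun setT f) (g : T2 -> \bar R) :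
  measurable_fun setT g -> (forall x, 0 <= g x)%E ->
  (\int[image_measure m mf]_y g y = \int[m]_x g (f x))%E.
Proof. by move=> mg g0; rewrite [LHS]ge0_integral_pushforward. Qed.

(** * Affine change of variable in Lebesgue integrals *)

Section LinearSubstitution.
Variable R : realType.
Local Notation mu := (@lebesgue_measure R).

Lemma measurable_affine (a b : R) :
  measurable_fun [set: measurableTypeR R]
    (fun x : measurableTypeR R => a * x + b : measurableTypeR R).
Proof. by apply: measurable_funD => //; apply: measurable_funM. Qed.

(** Lebesgue measure is determined by its values on the intervals []c, e]]. For [a < 0] the preimage
    of such an interval is closed on the left instead, which does not change its length. *)
Lemma lebesgue_measure_affine (a b : R) (A : set R) : a != 0 -> measurable A ->
  (mu A = mscale (NngNum (normr_ge0 a)) (image_measure mu (measurable_affine a b)) A)%E.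
Proof.
move=> a_neq0; apply: lebesgue_measure_unique => // _ [[c e]] /= ce <-.
rewrite /mscale /= /pushforward /=.
case: (ltgtP a 0) a_neq0 => // a0 _.
- have -> : (fun x => a * x + b) @^-1` `]c, e] = `[(e - b) / a, (c - b) / a[%classic.
    apply/seteqP; split => x /=; rewrite !in_itv/= ltr_ndivlMr// ler_ndivrMr//;
      rewrite ltrBlDr lerBrDr (mulrC x) andbC//.
  rewrite !lebesgue_measure_itv/= !lte_fin ltr_nM2r ?invr_lt0// ltrD2r.
  case: ifP => _; last by rewrite mule0.
  by rewrite -!EFinD -EFinM; congr (_%:E); rewrite ltr0_norm//; field; rewrite lt_eqF.
- have -> : (fun x => a * x + b) @^-1` `]c, e] = `](c - b) / a, (e - b) / a]%classic.
    apply/seteqP; split => x /=; rewrite !in_itv/= ltr_pdivrMr// ler_pdivlMr//;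
      rewrite ltrBlDr lerBrDr (mulrC x)//.
  rewrite !lebesgue_measure_itv/= !lte_fin ltr_pM2r ?invr_gt0// ltrD2r.
  case: ifP => _; last by rewrite mule0.
  by rewrite -!EFinD -EFinM; congr (_%:E); rewrite gtr0_norm//; field; rewrite gt_eqF.
Qed.

Lemma ge0_integral_affine (a b : R) (f : R -> \bar R) : a != 0 ->
  measurable_fun setT f -> (forall x, 0 <= f x)%E ->
  (\int[mu]_x f x = `|a|%:E * \int[mu]_x f (a * x + b)%R)%E.
Proof.
move=> a0 mf f0.
rewrite (eq_measure_integral (mscale (NngNum (normr_ge0 a))
  (image_measure mu (measurable_affine a b)))).
  by rewrite ge0_integral_mscale// ge0_integral_image_measure.
by move=> A mA _; exact: lebesgue_measure_affine.
Qed.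
End LinearSubstitution.

(** * The standard normal density and its invariance under rotations of the plane *)

Section StandardNormal.
Variable R : realType.
Local Notation mu := (@lebesgue_measure R).
Local Notation gamma := (@normal_prob R 0 1).
Local Notation phi := (@normal_pdf R 0 1).

(** The Radon-Nikodym derivative of [gamma] has the same integrals as [phi] over all measurable
    sets, so the two agree almost everywhere. *)
Lemma ge0_integral_normal (f : R -> \bar R) :
  measurable_fun setT f -> (forall x, 0 <= f x)%E ->
  (\int[gamma]_x f x = \int[mu]_x (f x * (phi x)%:E))%E.
Proof.
move=> mf f0.
have dom := @normal_prob_dominates R 0 1.
rewrite -(Radon_Nikodym_SigmaFinite.change_of_variables dom)//.
have rni := Radon_Nikodym_SigmaFinite.f_integrable dom.
apply: ae_eq_integral => //=.
- by apply: emeasurable_funM => //; exact: (measurable_int mu).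
- apply: emeasurable_funM => //; apply/measurable_EFinP.
  exact: measurable_normal_pdf.
- apply: ae_eqe_mul2l; apply: integral_ae_eq => //.
  + by apply/measurable_EFinP; exact: measurable_normal_pdf.
  + by move=> A _ mA; rewrite -Radon_Nikodym_SigmaFinite.f_integral.
Qed.

Lemma normal_pdf01E x : phi x = (Num.sqrt (pi *+ 2))^-1 * expR (- (x ^+ 2 / 2)).
Proof.
rewrite /normal_pdf oner_eq0 /normal_peak /normal_fun.
by rewrite expr1n mul1r subr0 mulNr.
Qed.

(** With [z = (t - s * x) / b], the point [(x, z)] has in another orthonormal basis of the plane the
    coordinates [t / r] and, up to sign, [(r ^+ 2 * x - s * t) / (r * b)]. The sum of squares in the
    exponent is therefore the same on both sides. *)
Lemma normal_pdf_rotate (s b t x r : R) : b != 0 ->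
  r = Num.sqrt (s ^+ 2 + b ^+ 2) ->
  phi (b^-1 * t + - (s * x / b)) * phi x =
  phi (r / `|b| * x + (- (s * t / (r * `|b|)))) * phi (t / r).
Proof.
move=> b0 rE; rewrite !normal_pdf01E.
rewrite mulrACA [RHS]mulrACA -!expRD; congr (_ * expR _).
have r2 : r ^+ 2 = s ^+ 2 + b ^+ 2 by rewrite rE sqr_sqrtr// addr_ge0 ?sqr_ge0.
have r0 : r != 0.
  by rewrite -(sqrf_eq0 r) r2 paddr_eq0 ?sqr_ge0// negb_and !sqrf_eq0 b0 orbT.
have -> : (r / `|b| * x - s * t / (r * `|b|)) = (r ^+ 2 * x - s * t) / r * `|b|^-1.
  by rewrite r2; field: r2; rewrite r0 normr_eq0 b0.
rewrite [X in _ = - (X / 2) - _]exprMn exprVn real_normK ?num_real//.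
rewrite !exprMn exprVn.
by rewrite r2; field; rewrite b0 -r2 expf_eq0 r0.
Qed.

Lemma ge0_integral_normal_comb (s b : R) (f : R -> \bar R) : b != 0 ->
  measurable_fun setT f -> (forall x, 0 <= f x)%E ->
  (\int[gamma]_x \int[gamma]_z f (s * x + b * z)%R =
   \int[gamma]_x f (Num.sqrt (s ^+ 2 + b ^+ 2) * x)%R)%E.
Proof.
move=> b0 mf f0; set r := Num.sqrt _.
have r2 : r ^+ 2 = s ^+ 2 + b ^+ 2 by rewrite sqr_sqrtr// addr_ge0 ?sqr_ge0.
have r_gt0 : 0 < r.
  by rewrite sqrtr_gt0 ltr_wpDl ?sqr_ge0// exprn_even_gt0.
have mphi : measurable_fun [set: R] (EFin \o phi).
  by apply/measurable_EFinP; exact: measurable_normal_pdf.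
have phi0 x : (0 <= (phi x)%:E)%E by rewrite lee_fin normal_pdf_ge0.
have mfphi (a c a' c' : R) :
    measurable_fun setT (fun x => f (a * x + c)%R * (phi (a' * x + c'))%:E)%E.
  apply: emeasurable_funM.
    exact: (measurableT_comp mf (measurable_affine a c)).
  exact: (measurableT_comp mphi (measurable_affine a' c')).
(* The substitution [t = s * x + b * z] at fixed [x] makes [f] depend on [t] alone. *)
have inner x : (\int[gamma]_z f (s * x + b * z)%R =
    \int[mu]_t (f t * (`|b|^-1 * phi (b^-1 * t + - (s * x / b)))%:E))%E.
  rewrite ge0_integral_normal//; last first.
    under eq_fun do rewrite addrC.
    exact: (measurableT_comp mf (measurable_affine _ _)).
  have HE t : s * x + b * (b^-1 * t + - (s * x / b)) = t by field.
  rewrite (@ge0_integral_affine _ (b^-1) (- (s * x / b)))//; first last.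
  - by move=> z; rewrite mule_ge0.
  - under eq_fun => z do rewrite [X in f X]addrC -[X in phi X]mul1r -[X in phi X]addr0.
    exact: mfphi.
  - by rewrite invr_eq0.
  rewrite -ge0_integralZl//=; first last.
  - by move=> t _; rewrite mule_ge0.
  - under eq_fun => t do rewrite HE -[X in f X]mul1r -[X in f X]addr0.
    exact: mfphi.
  apply: eq_integral => t _; rewrite HE EFinM muleCA normfV//.
have mJ : measurable_fun [set: R * R] (fun z => (f z.2 *
    (`|b|^-1 * phi (b^-1 * z.2 + - (s * z.1 / b)) * phi z.1)%:E)%E).
  apply: emeasurable_funM; first exact: (measurableT_comp mf).
  apply/measurable_EFinP; apply: measurable_funM; last first.
    by apply: measurableT_comp => //; exact: measurable_normal_pdf.
  apply: measurable_funM => //; apply: measurableT_comp.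
    exact: measurable_normal_pdf.
  apply: measurable_funD; first exact: measurable_funM.
  apply: measurableT_comp => //; apply: measurable_funM => //.
  by apply: measurable_funM => //.
rewrite ge0_integral_normal//; first last.
- by move=> x; apply: integral_ge0.
- under eq_fun do rewrite inner.
  apply: (measurable_fun_fubini_tonelli_F (m2 := mu) (fun z : R * R => (f z.2 *
    (`|b|^-1 * phi (b^-1 * z.2 + - (s * z.1 / b)))%:E)%E)).
  + apply: emeasurable_funM; first exact: (measurableT_comp mf).
    apply/measurable_EFinP; apply: measurable_funM => //; apply: measurableT_comp.
      exact: measurable_normal_pdf.
    apply: measurable_funD; first exact: measurable_funM.
    apply: measurableT_comp => //; apply: measurable_funM => //.
    by apply: measurable_funM => //.
  + by move=> x; rewrite mule_ge0// lee_fin mulr_ge0// normal_pdf_ge0.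
transitivity (\int[mu]_x \int[mu]_t (f t *
    (`|b|^-1 * phi (b^-1 * t + - (s * x / b)) * phi x)%:E))%E.
  apply: eq_integral => x _; rewrite inner -ge0_integralZr//.
  - by apply: eq_integral => t _; rewrite -muleA -EFinM.
  - under eq_fun => t do rewrite EFinM muleCA -[X in f X]mul1r -[X in f X]addr0.
    by apply: measurable_funeM; exact: mfphi.
  - by move=> t _; rewrite mule_ge0// lee_fin mulr_ge0// normal_pdf_ge0.
have := @fubini_tonelli _ _ _ _ _ mu mu _ mJ; rewrite /= => ->; last first.
  by move=> z; rewrite mule_ge0// lee_fin !mulr_ge0// normal_pdf_ge0.
rewrite [RHS]ge0_integral_normal//; last first.
  under eq_fun do rewrite -[X in f X]addr0.
  exact: (measurableT_comp mf (measurable_affine _ _)).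
have phi1 : (\int[mu]_x (phi x)%:E = 1)%E := integral_normal_pdf 0 1.
transitivity (\int[mu]_t (f t * (phi (r^-1 * t + 0) / r)%:E))%E.
  apply: eq_integral => t _.
  (* After the rotation, [x] occurs only in a normal density composed with an affine map of slope
     [r / |b|], whose integral is [|b| / r]. *)
  transitivity (\int[mu]_x ((f t * (`|b|^-1 * phi (t / r))%:E) *
     (phi (r / `|b| * x + (- (s * t / (r * `|b|)))))%:E))%E.
    apply: eq_integral => x _; rewrite -muleA -EFinM -mulrA (normal_pdf_rotate _ _ b0 erefl).
    by congr (_ * (_)%:E)%E; ring.
  rewrite ge0_integralZl//; first last.
  - by rewrite mule_ge0// lee_fin mulr_ge0 ?normal_pdf_ge0.
  - exact: (measurableT_comp mphi (measurable_affine _ _)).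
  rewrite -muleA; congr (_ * _)%E.
  have rb0 : r / `|b| != 0 by rewrite gt_eqF// divr_gt0 ?normr_gt0.
  have HI := @ge0_integral_affine _ _ (- (s * t / (r * `|b|))) (EFin \o phi)
    rb0 mphi phi0.
  rewrite /= phi1 gtr0_norm in HI; last by rewrite divr_gt0 ?normr_gt0.
  have -> : `|b|^-1 * phi (t / r) = phi (t / r) / r * (r / `|b|).
    by field; rewrite normr_eq0 b0 (gt_eqF r_gt0).
  by rewrite EFinM -muleA -HI mule1 addr0 (mulrC r^-1).
rewrite (@ge0_integral_affine _ r 0) ?gt_eqF// ?gtr0_norm//; first last.
- by move=> x; rewrite mule_ge0// lee_fin divr_ge0 ?normal_pdf_ge0// ltW.
- under eq_fun => t do rewrite EFinM muleA -[X in f X]mul1r -[X in f X]addr0.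
  by apply: emeasurable_funM; [exact: mfphi|exact: measurable_cst].
rewrite -ge0_integralZl//; first last.
- by rewrite lee_fin ltW.
- by move=> x _; rewrite mule_ge0// lee_fin divr_ge0 ?normal_pdf_ge0// ltW.
- have -> : (fun x => f (r * x + 0)%R * (phi (r^-1 * (r * x + 0) + 0) / r)%:E)%E =
     (fun x => f (r * x + 0)%R * (phi (1 * x + 0))%:E * (r^-1)%:E)%E.
    by apply/funext => x; rewrite EFinM !muleA !addr0 mulKf ?gt_eqF// mul1r.
  by apply: emeasurable_funM; [exact: mfphi|exact: measurable_cst].
apply: eq_integral => x _; rewrite !addr0 mulKf ?gt_eqF// muleCA -EFinM.
by congr (_ * _%:E)%E; field; rewrite gt_eqF.
Qed.
End StandardNormal.

(** A name for [mscale c m] that carries the structure of a finite measure, as needed to use it as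
    second factor of a product measure. *)
Definition scaled_measure d (T : measurableType d) (R : realType) (c : {nonneg R})
  (m : {finite_measure set T -> \bar R}) := mscale c m.

Section ScaledMeasure.
Context d (T : measurableType d) (R : realType) (c : {nonneg R})
  (m : {finite_measure set T -> \bar R}).
HB.instance Definition _ := Measure.on (scaled_measure c m).
Lemma scaled_measure_finite : fin_num_fun (scaled_measure c m).
Proof. by move=> A mA; rewrite fin_numM// fin_num_measure. Qed.
HB.instance Definition _ := @Measure_isFinite.Build _ _ _
  (scaled_measure c m) scaled_measure_finite.
End ScaledMeasure.

Definition image_probability d1 d2 (T1 : measurableType d1)
    (T2 : measurableType d2) (R : realType) (P : probability T1 R) (f : T1 -> T2)
    (mf : measurable_fun setT f) : probability T2 R :=
  distribution P (HB.pack f (isMeasurableFun.Build _ _ _ _ _ mf) : {mfun T1 >-> T2}).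

Lemma measurable_scaleR (R : realType) (s : R) :
  measurable_fun [set: measurableTypeR R] (fun x : measurableTypeR R => s * x : R).
Proof. exact: mulrl_measurable. Qed.

(** The image of [gamma] under the identity is its copy on the type [R], where random variables take
    their values. *)
Lemma measurable_idR (R : realType) :
  measurable_fun [set: measurableTypeR R] (fun x : measurableTypeR R => x : R).
Proof. exact: measurable_id. Qed.

(** * Linear combinations of independent standard normal variables *)

Section NormalLaw.
Variable R : realType.
Local Notation gamma := (@normal_prob R 0 1).

(* [L] has the law of [s * N] with [N] standard normal; unlike [normal_prob 0 s]
   this is correct at [s = 0] too. *)
Definition scaled_normal d (T : measurableType d) (P : probability T R)
    (L : T -> R) (s : R) : Prop :=
  forall f : R -> \bar R, measurable_fun setT f -> (forall x, 0 <= f x)%E ->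
  (\int[P]_w f (L w) = \int[gamma]_x f (s * x)%R)%E.

Lemma ge0_integral_normal_comb0 (s b : R) (f : R -> \bar R) : 0 <= s ->
  measurable_fun setT f -> (forall x, 0 <= f x)%E ->
  (\int[gamma]_x \int[gamma]_z f (s * x + b * z)%R =
   \int[gamma]_x f (Num.sqrt (s ^+ 2 + b ^+ 2) * x)%R)%E.
Proof.
move=> s0 mf f0; have [->|b0] := eqVneq b 0; last exact: ge0_integral_normal_comb.
apply: eq_integral => x _; rewrite expr0n addr0 sqrtr_sqr ger0_norm//.
under eq_integral do rewrite mul0r addr0.
rewrite integral_cst//= ?probability_setT ?mule1//.
Qed.

Lemma measurable_scale (s : R) (f : R -> \bar R) :
  measurable_fun setT f -> measurable_fun setT (fun x => f (s * x)%R).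
Proof.
move=> mf; apply: (measurableT_comp mf); apply: measurable_funM => //.
Qed.

Section Independence.
Context d (T : measurableType d) (P : probability T R) (k : nat)
  (Z : 'I_k -> {RV P >-> R}) (b : 'I_k -> R).
Hypothesis indepZ : independent_RVs Z.
Hypothesis normalZ : forall j (B : set R), measurable B ->
  distribution P (Z j) B = gamma B.

Let L (j : nat) (w : T) : R := \sum_(i < k | (i < j)%N) b i * Z i w.
Let s (j : nat) : R := Num.sqrt (\sum_(i < k | (i < j)%N) b i ^+ 2).
Let D (B : 'I_k -> set R) (j : nat) : set T :=
  \bigcap_(i in [set` [set i : 'I_k | (j <= i)%N]%SET]) (Z i @^-1` B i).

Let measurable_L j : measurable_fun setT (L j).
Proof.
rewrite (_ : L j = fun w => \sum_(i < k) if (i < j)%N then b i * Z i w else 0); last first.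
  by apply/funext => w; rewrite /L big_mkcond.
by apply: measurable_sum => i; case: (i < j)%N => //; exact: measurable_funM.
Qed.

Let measurable_D B j : (forall i, measurable (B i)) -> measurable (D B j).
Proof.
move=> mB; apply: fin_bigcap_measurable; first exact: finite_finset.
by move=> i _; rewrite -[X in measurable X]setTI; exact: measurable_funP.
Qed.

(** Independence is a product formula for events on the single [Z i]. Carrying the event [D B j] on
    the variables not yet summed keeps the statement usable at the next step: it says that the
    partial sum is independent of them. *)
Let partial_sum_law (j : nat) : (j <= k)%N ->
  forall (A : set R) (B : 'I_k -> set R), measurable A ->
  (forall i, measurable (B i)) ->
  (P (L j @^-1` A `&` D B j) = gamma [set x | A (s j * x)%R] * P (D B j))%E.
Proof.
elim: j => [_|j IH jk] A B mA mB.
  have L0 : L 0 = cst 0 by apply/funext => w; rewrite /L big_pred0.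
  have s0 : s 0 = 0 by rewrite /s big_pred0// sqrtr0.
  rewrite L0 s0 preimage_cst; under eq_set do rewrite mul0r.
  case: ifPn => [/set_mem A0|/negP A0].
    rewrite setTI [X in gamma X](_ : _ = setT) ?probability_setT ?mul1e//.
    by apply/seteqP; split.
  rewrite set0I [X in gamma X](_ : _ = set0) ?measure0 ?mul0e//.
  by apply/seteqP; split => // x /mem_set.
set o := Ordinal jk.
have SL w : L j.+1 w = L j w + b o * Z o w.
  rewrite /L (bigD1 o)//= addrC; congr (_ + _); apply: eq_bigl => i.
  by rewrite ltnS -val_eqE/= [RHS]ltn_neqAle andbC.
have Ss : s j.+1 = Num.sqrt (s j ^+ 2 + b o ^+ 2).
  rewrite /s sqr_sqrtr ?sumr_ge0// => [|i _]; last exact: sqr_ge0.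
  rewrite (bigD1 o)//= addrC; congr (Num.sqrt (_ + _)); apply: eq_bigl => i.
  by rewrite ltnS -val_eqE/= [RHS]ltn_neqAle andbC.
have mD := measurable_D j.+1 mB.
have mpair : measurable_fun setT (fun w => (L j w, Z o w)).
  by apply: measurable_fun_pair => //; exact: measurable_L.
have PDfin : P (D B j.+1) \is a fin_num by exact: fin_num_measure.
have PD0 : 0 <= fine (P (D B j.+1)) by exact: fine_ge0.
pose m1 : probability R R := image_probability gamma (measurable_scaleR (s j)).
pose m2 : {finite_measure set R -> \bar R} :=
  scaled_measure (NngNum PD0) (image_probability gamma (@measurable_idR R)).
(* [m'] is the joint law of the partial sum and of the next variable, restricted to the event on the
   later ones. It agrees with the product [m1 \x m2] on rectangles, hence on every measurable set,
   in particular on the preimage of [A] under [z.1 + b o * z.2]. *)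
pose m' : {measure set (_ * _) -> \bar R} := image_measure (mrestr P mD) mpair.
have m'E : forall X : set (R * R), measurable X -> (m1 \x m2)%E X = m' X.
  apply: product_measure_unique => A1 A2 mA1 mA2.
  (* Putting [A2] at index [o] turns the constraint on [Z o] into part of the event to which the
     induction hypothesis applies. *)
  pose B' i := if i == o then A2 else B i.
  have mB' i : measurable (B' i) by rewrite /B'; case: eqP.
  have DE : D B' j = (Z o @^-1` A2) `&` D B j.+1.
    apply/seteqP; split => w.
      move=> Dw; split.
        by have := Dw o; rewrite /B' eqxx; apply; rewrite /= inE.
      move=> i /=; rewrite inE => ji; have := Dw i; rewrite /B' ifF.
        by apply; rewrite /= inE ltnW.
      by apply/eqP => io; rewrite io ltnn in ji.
    move=> [w2 Dw] i /=; rewrite inE /B'; case: eqP => [->//|/eqP io] ji.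
    by apply: Dw; rewrite /= inE ltn_neqAle ji andbT eq_sym.
  have -> : m' (A1 `*` A2) = P (L j @^-1` A1 `&` D B' j).
    rewrite /m' image_measureE /mrestr DE setIA; congr (P (_ `&` _)).
  rewrite (IH (ltnW jk))// DE.
  have -> : P (Z o @^-1` A2 `&` D B j.+1) = (gamma A2 * P (D B j.+1))%E.
    rewrite -DE /D !indepZ// (bigD1 o)/= ?inE//; congr (_ * _)%E.
      by rewrite /B' eqxx; exact: normalZ.
    apply: eq_big => i; first by rewrite !inE ltn_neqAle andbC eq_sym.
    by rewrite /B' => /andP[_ /negbTE ->].
  rewrite /m1 /m2/= /scaled_measure/mscale /= fineK//.
  by rewrite (muleC (P _)).
pose X : set (R * R) := [set z | A (z.1 + b o * z.2)].
have mX : measurable X.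
  rewrite -[X]setTI; apply: (_ : measurable_fun setT (fun z : R * R => z.1 + b o * z.2)) => //.
  by apply: measurable_funD => //; exact: measurable_funM.
have mA1 : measurable_fun setT (fun x : R => (\1_A x)%:E : \bar R).
  by apply/measurable_EFinP; exact: measurable_indic.
have A1_ge0 (x : R) : (0 <= (\1_A x)%:E :> \bar R)%E by rewrite lee_fin.
have indE (g : R -> R) : measurable_fun [set: measurableTypeR R] g ->
    (gamma [set x | A (g x)] = \int[gamma]_x (\1_A (g x))%:E)%E.
  move=> mg; have mAg : measurable [set x : measurableTypeR R | A (g x)].
    by rewrite -[X in measurable X]setTI; exact: mg.
  rewrite -[X in gamma X]setIT -integral_indic//.
have -> : P (L j.+1 @^-1` A `&` D B j.+1) = m' X.
  rewrite /m' image_measureE /mrestr; congr (P (_ `&` _)).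
  by apply/seteqP; split => w; rewrite /X /= SL.
rewrite -m'E// /product_measure1 /m1 ge0_integral_distribution//; last first.
  exact: measurable_fun_xsection.
transitivity (\int[gamma]_x (P (D B j.+1) *
    \int[gamma]_z (\1_A (s j * x + b o * z)%R)%:E))%E.
  apply: eq_integral => x _ /=; rewrite /m2/= /scaled_measure /mscale/= fineK//.
  congr (_ * _)%E; rewrite -indE; last first.
    by apply: measurable_funD => //; exact: measurable_scaleR.
  by rewrite /distribution /pushforward /=; congr (gamma _); apply/seteqP; split => z /=;
     rewrite /xsection /= inE.
rewrite ge0_integralZl//=; first last.
- by move=> x _; apply: integral_ge0.
- apply: (measurable_fun_fubini_tonelli_F (m2 := gamma)
    (fun z : measurableTypeR R * measurableTypeR R =>
       (\1_A (s j * z.1 + b o * z.2)%R)%:E)); last by [].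
  apply: (measurableT_comp mA1); apply: measurable_funD => //.
    by apply: (measurableT_comp (measurable_scaleR _)).
  by apply: (measurableT_comp (measurable_scaleR _)).
rewrite (@ge0_integral_normal_comb0 _ _ (fun x => (\1_A x)%:E)) ?sqrtr_ge0//.
by rewrite muleC -Ss indE//; exact: measurable_scaleR.
Qed.

Lemma scaled_normal_sum :
  scaled_normal P (fun w => \sum_(i < k) b i * Z i w)
    (Num.sqrt (\sum_(i < k) b i ^+ 2)).
Proof.
move=> f mf f0.
have LE : (fun w => \sum_(i < k) b i * Z i w) = L k.
  by apply/funext => w; apply: eq_bigl => i; rewrite ltn_ord.
have sE : Num.sqrt (\sum_(i < k) b i ^+ 2) = s k.
  by congr Num.sqrt; apply: eq_bigl => i; rewrite ltn_ord.
rewrite sE -(ge0_integral_image_measure _ (measurable_scaleR (s k)))//.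
transitivity (\int[P]_w f (L k w))%E; first by rewrite -LE.
rewrite -(ge0_integral_image_measure _ (measurable_L k))//.
apply: eq_measure_integral => A mA _; rewrite !image_measureE.
have DT : D (fun=> setT) k = setT.
  by apply/seteqP; split => w // _ i _.
have := partial_sum_law (leqnn k) mA (fun=> measurableT).
by rewrite DT setIT probability_setT mule1.
Qed.
End Independence.
End NormalLaw.

(** * The second moment of the standard normal law *)

Section NormalMoments.
Variable R : realType.
Local Notation mu := (@lebesgue_measure R).
Local Notation gamma := (@normal_prob R 0 1).
Local Notation phi := (@normal_pdf R 0 1).

Lemma normal_pdfN x : phi (- x) = phi x.
Proof. by rewrite !normal_pdf01E sqrrN. Qed.

Lemma continuous_phi : continuous phi.
Proof. by apply: continuous_normal_pdf; exact: oner_neq0. Qed.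

Lemma is_derive_normal_pdf (x : R) : is_derive x 1 (fun x => - phi x) (x * phi x).
Proof.
have -> : (fun x => - phi x) =
    (fun x => - (Num.sqrt (pi *+ 2))^-1 * expR (- (x ^+ 2 / 2))).
  by apply/funext => u; rewrite normal_pdf01E mulNr.
apply: is_derive_eq.
by rewrite normal_pdf01E /GRing.scale/= !mulr0 add0r; set C := (Num.sqrt _)^-1; field.
Qed.

(** [- phi] is a primitive of [u * phi u] and tends to 0 at infinity. *)
Lemma normal_pdf_tail (x : R) : 0 <= x ->
  (\int[mu]_(u in `[x, +oo[) (u * phi u)%:E = (phi x)%:E)%E.
Proof.
move=> x0; rewrite (@ge0_continuous_FTC2y _ _ (fun x => - phi x) x 0).
- by rewrite EFinN oppeK add0e.
- by move=> u xu; rewrite mulr_ge0 ?normal_pdf_ge0// (le_trans x0).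
- apply: continuous_subspaceT => u; apply: continuousM => //; exact: continuous_phi.
- rewrite -[X in _ --> X]oppr0; apply: cvgN.
  have -> : phi = (fun x => (Num.sqrt (pi *+ 2))^-1 * expR (- (x ^+ 2 / 2))).
    by apply/funext => u; rewrite normal_pdf01E.
  rewrite -(mulr0 (Num.sqrt (pi *+ 2))^-1); apply: cvgMr.
  apply: (cvg_comp (fun u : R => u ^+ 2 / 2) (fun x => expR (- x))).
    by apply: gt0_cvgMly => //; exact: cvgr_expr2.
  exact: cvgr_expR.
- by move=> u _; have [] := is_derive_normal_pdf u.
- apply: cvg_at_right_filter; apply: cvgN; exact: continuous_phi.
- by move=> u _; rewrite derive1E; have [_] := is_derive_normal_pdf u.
Qed.

(** Integration by parts in the form of Tonelli's theorem on the region [0 <= x <= u]: integrating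
    [u * phi u] over [x] gives [u ^+ 2 * phi u], and integrating it over [u] gives [phi x]. *)
Lemma normal_second_moment : (\int[gamma]_x (x ^+ 2)%:E = 1)%E.
Proof.
rewrite ge0_integral_normal; last 2 first.
- by apply/measurable_EFinP; exact: measurable_funX.
- by move=> x; rewrite lee_fin sqr_ge0.
under eq_integral do rewrite -EFinM.
rewrite (@ge0_symfun_integralT _ (fun x => x ^+ 2 * phi x)); last 3 first.
- by move=> x; rewrite mulr_ge0 ?sqr_ge0 ?normal_pdf_ge0.
- move=> x; apply: (@continuousM _ _ (fun x : R => x ^+ 2) phi).
    exact: exprn_continuous.
  exact: continuous_phi.
- by move=> x /=; rewrite sqrrN normal_pdfN.
(* The right-hand side 1 is rewritten as the mass of [phi], folded in the same way, so that only two
   integrals over the half line are left to compare. *)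
have := @integral_normal_pdf R 0 1.
rewrite ge0_symfun_integralT; last 3 first.
- by move=> x; rewrite normal_pdf_ge0.
- exact: continuous_phi.
- by move=> x /=; rewrite normal_pdfN.
move=> <-; congr (_ * _)%E.
pose E : set (R * R) := [set z | 0 <= z.1 <= z.2].
have mE : measurable E.
  have -> : E = [set z | 0 <= z.1] `&` [set z | z.1 <= z.2].
    by apply/seteqP; split => z /=; [move/andP|move=> [? ?]; apply/andP].
  apply: measurableI; rewrite -[X in measurable X]setTI.
    exact: (@measurable_fun_ler _ _ _ _ (cst 0) fst).
  exact: (@measurable_fun_ler _ _ _ _ fst snd).
pose J (z : R * R) := (\1_E z * (z.2 * phi z.2))%:E.
have mJ : measurable_fun setT J.
  apply/measurable_EFinP; apply: measurable_funM; first exact: measurable_indic.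
  apply: measurable_funM => //; apply: (measurableT_comp _ measurable_snd).
  exact: measurable_normal_pdf.
have J0 z : (0 <= J z)%E.
  rewrite lee_fin indicE; have [/set_mem/andP[z1 z12]|_] := boolP (z \in E).
    by rewrite mul1r mulr_ge0 ?normal_pdf_ge0// (le_trans z1).
  by rewrite mul0r.
have := @fubini_tonelli _ _ _ _ _ mu mu _ mJ J0 => FT.
have Jx0 (x y : R) : ~~ (0 <= x <= y) -> J (x, y) = 0%E.
  by move=> /negP xy; rewrite /J indicE memNset ?mul0r.
have Jxy (x u : R) : 0 <= x -> x <= u -> J (x, u) = (u * phi u)%:E.
  move=> x0 xu; have Exu : E (x, u) by apply/andP; split.
  by rewrite /J indicE (mem_set Exu) mul1r.
have innerx (u : R) : 0 <= u -> (\int[mu]_x J (x, u) = (u ^+ 2 * phi u)%:E)%E.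
  move=> u0.
  have mI : measurable_fun [set: R] (fun x => (\1_(`[0, u]%classic : set R) x)%:E : \bar R).
    by apply/measurable_EFinP; exact: measurable_indic.
  transitivity (\int[mu]_x ((u * phi u)%:E * (\1_(`[0, u]%classic) x)%:E))%E.
    by apply: eq_integral => x _; rewrite /J -EFinM !indicE !mem_setE/= in_itv/= mulrC.
  rewrite (ge0_integralZl mu measurableT mI); last 2 first.
  - by move=> x _; rewrite lee_fin.
  - by rewrite lee_fin mulr_ge0 ?normal_pdf_ge0.
  have mi : measurable (`[0, u]%classic : set R) by exact: measurable_itv.
  have mui : mu (`[0, u]%classic : set R) = u%:E.
    rewrite lebesgue_measure_itv/= lte_fin oppr0 adde0.
    by move: u0; rewrite le_eqVlt => /predU1P[<-|->//]; rewrite ltxx.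
  rewrite (integral_indic mu measurableT mi) setIT.
  transitivity ((u * phi u)%:E * u%:E)%E; last by rewrite -EFinM expr2 mulrAC.
  by congr (_ * _)%E; exact: mui.
have innery (x : R) : 0 <= x -> (\int[mu]_u J (x, u) = (phi x)%:E)%E.
  move=> x0; rewrite -(normal_pdf_tail x0) [RHS]integral_mkcond.
  apply: eq_integral => u _.
  rewrite patchE; case: ifPn => [/set_mem|/negP].
    by rewrite /= in_itv/= andbT => xu; rewrite Jxy.
  move=> xu; apply: Jx0; apply/negP => /andP[_ xu']; apply: xu.
  by rewrite inE/= in_itv/= andbT.
transitivity (\int[mu]_y \int[mu]_x J (x, y))%E.
  rewrite integral_mkcond; apply: eq_integral => u _.
  rewrite patchE; case: ifPn => [/set_mem/= u0|/negP u0]; first by rewrite innerx.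
  apply/esym; apply: integral0_eq => x _; apply: Jx0; apply/negP => /andP[x0 xu].
  by apply: u0; rewrite inE/= (le_trans x0).
rewrite -FT [RHS]integral_mkcond; apply: eq_integral => x _.
rewrite patchE; case: ifPn => [/set_mem/= x0|/negP x0]; first by rewrite innery.
apply: integral0_eq => u _; apply: Jx0; apply/negP => /andP[x0' xu].
by apply: x0; rewrite inE.
Qed.
End NormalMoments.

(** * The law of the square of a standard normal variable *)

Section ChiSquare.
Variable R : realType.
Local Notation mu := (@lebesgue_measure R).
Local Notation gamma := (@normal_prob R 0 1).
Local Notation phi := (@normal_pdf R 0 1).

(** The derivative of the square root is unbounded near 0; starting at [b > 0] gives it a finite
    limit at the left endpoint, as the substitution theorem requires. *)
Lemma ge0_integral_sqrt_subst (b : R) (G : R -> R) : 0 < b ->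
  continuous G -> (forall x, 0 <= G x) ->
  (\int[mu]_(x in `[b, +oo[) (G x)%:E =
   \int[mu]_(t in `[(b ^+ 2)%R, +oo[) (G (Num.sqrt t) * (2 * Num.sqrt t)^-1)%:E)%E.
Proof.
move=> b0 cG G0.
have b2 : 0 < b ^+ 2 by rewrite exprn_gt0.
pose F' : R -> R := (fun t : R => (2 * Num.sqrt t)^-1).
have F'E (t : R) : 0 < t ->
    ((@Num.sqrt R : R -> R)^`()%classic : R -> R) t = F' t.
  by move=> t0; rewrite derive1E derive_sqrt.
have cF' (t : R) : 0 < t -> F' x @[x --> t] --> F' t.
  move=> t0; apply: cvgV; first by rewrite mulf_neq0// gt_eqF// sqrtr_gt0.
  by apply: cvgMr; exact: sqrt_continuous.
have ->: b = Num.sqrt (b ^+ 2) by rewrite sqrtr_sqr gtr0_norm.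
rewrite sqr_sqrtr ?ltW// increasing_ge0_integration_by_substitutiony//.
- apply: eq_integral => t; rewrite inE/= in_itv/= andbT => tb.
  by rewrite fctE/= F'E// (lt_le_trans b2).
- move=> x y; rewrite !in_itv/= !andbT => xb yb xy.
  by rewrite ltr_sqrt// (lt_le_trans b2).
- move=> x; rewrite in_itv/= andbT => xb.
  have x0 : 0 < x by rewrite (lt_trans b2).
  rewrite /continuous_at F'E//; apply: cvg_trans (cF' _ x0).
  apply: near_eq_cvg; near=> t; rewrite F'E//; near: t.
  exact: lt_nbhsr.
- apply/cvg_ex; exists (F' (b ^+ 2)).
  apply: cvg_trans (cvg_at_right_filter (cF' _ b2)).
  apply: near_eq_cvg; near=> t; rewrite F'E// (lt_trans b2)//.
- apply/cvg_ex; exists 0; apply: (@cvg_trans _ (F' @ +oo)).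
    apply: near_eq_cvg; near=> t.
    have t0 : 0 < t by near: t; exact/nbhs_pinfty_gt/num_real.
    by rewrite F'E.
  apply/cvgrPdist_le => e e0; near=> t.
  have et : e^-1 <= Num.sqrt t.
    rewrite -[e^-1]gtr0_norm ?invr_gt0// -sqrtr_sqr ler_wsqrtr//.
  have st : 0 < Num.sqrt t by rewrite (lt_le_trans _ et)// invr_gt0.
  rewrite sub0r normrN ger0_norm ?invr_ge0 ?mulr_ge0//.
  by rewrite invf_ple ?posrE ?mulr_gt0// (le_trans et)// ler_peMl ?ltW// ltr1n.
- split.
    move=> x; rewrite in_itv/= andbT => bx.
    by have [] := is_derive1_sqrt (lt_trans b2 bx).
  by apply: cvg_at_right_filter; exact: sqrt_continuous.
- apply/cvgryPge => A; near=> t.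
  rewrite (le_trans (ler_norm A))// -sqrtr_sqr ler_wsqrtr//.
- exact: continuous_subspaceT.
Unshelve. all: by end_near.
Qed.

(** The chi-square density with [2 * a] degrees of freedom, without its normalizing constant. *)
Definition chi2_density (R : realType) (a t : R) : R := t `^ (a - 1) * expR (- (t / 2)).

Lemma chi2_density_ge0 (a t : R) : 0 <= chi2_density a t.
Proof. by rewrite mulr_ge0 ?powR_ge0 ?expR_ge0. Qed.

Lemma measurable_chi2_density (a : R) : measurable_fun setT (chi2_density a).
Proof.
apply: measurable_funM; first exact: measurable_powR.
apply: measurableT_comp => //; apply: measurableT_comp => //.
exact: measurable_funM.
Qed.

(** By parity the integral is twice that over the positive half line, where [t = x ^+ 2] is a change
    of variable with density [1 / (2 * sqrt t)]; the constant is that of [phi]. *)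
Lemma ge0_integral_normal_sqr (f : R -> R) : continuous f -> (forall x, 0 <= f x) ->
  (\int[gamma]_x (f (x ^+ 2))%:E = ((Num.sqrt (pi *+ 2))^-1)%:E *
   \int[mu]_(t in `]0%R, +oo[) (f t * chi2_density (2^-1) t)%:E)%E.
Proof.
move=> cf f0; set C := _^-1.
have C0 : 0 <= C by rewrite invr_ge0.
pose G := fun x : R => f (x ^+ 2) * phi x.
have cfx : continuous (fun x : R => f (x ^+ 2)).
  by move=> x; apply: continuous_comp; [exact: exprn_continuous|exact: cf].
have cG : continuous G by move=> x; apply: continuousM; [exact: cfx|exact: continuous_phi].
have G0 x : 0 <= G x by rewrite mulr_ge0 ?normal_pdf_ge0.
have mG : measurable_fun setT (EFin \o G).
  by apply/measurable_EFinP; exact: continuous_measurable_fun.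
pose H t := 2 * G (Num.sqrt t) * (2 * Num.sqrt t)^-1.
pose K t := C * (f t * chi2_density (2^-1) t).
have K0 t : 0 <= K t.
  by apply: mulr_ge0 => //; apply: mulr_ge0 => //; exact: chi2_density_ge0.
have mK : measurable_fun setT K.
  apply: measurable_funM => //; apply: measurable_funM.
    exact: continuous_measurable_fun.
  exact: measurable_chi2_density.
have HK t : 0 < t -> H t = K t.
  move=> t0; rewrite /H /G /K /chi2_density sqr_sqrtr ?ltW// normal_pdf01E.
  rewrite sqr_sqrtr ?ltW// -/C.
  have -> : 2^-1 - 1 = - 2^-1 :> R by field.
  rewrite powRN powR12_sqrt ?ltW//; field.
  by rewrite gt_eqF// sqrtr_gt0.
rewrite ge0_integral_normal; last 2 first.
- by apply/measurable_EFinP; exact: continuous_measurable_fun.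
- by move=> x; rewrite lee_fin.
transitivity (\int[mu]_x (G x)%:E)%E; first by apply: eq_integral => x _; rewrite -EFinM.
rewrite (@ge0_symfun_integralT _ G)//; last first.
  by move=> x /=; rewrite /G sqrrN normal_pdfN.
transitivity (\int[mu]_(x in `]0%R, +oo[) (2 * G x)%:E)%E.
  have E0 : [set x : R | 0 <= x] = `[0, +oo[%classic.
    by apply/seteqP; split => x /=; rewrite in_itv/= andbT.
  rewrite -ge0_integralZl//=; last 3 first.
  - by rewrite E0; exact: measurable_itv.
  - exact: measurable_funTS.
  - by move=> x _; rewrite lee_fin.
  transitivity (\int[mu]_(x in `[0%R, +oo[) (2 * G x)%:E)%E.
    by rewrite E0; apply: eq_integral => x _; rewrite -EFinM.
  rewrite -[LHS]integral_itv_obnd_cbnd//.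
  apply/measurable_funTS/measurable_EFinP; apply: measurable_funM => //.
  exact: continuous_measurable_fun.
transitivity (\int[mu]_(x in `]0%R, +oo[) (K x)%:E)%E; last first.
  rewrite -[RHS]ge0_integralZl//.
  - apply/measurable_EFinP; apply: measurable_funTS; apply: measurable_funM.
      exact: continuous_measurable_fun.
    exact: measurable_chi2_density.
  - by move=> t _; rewrite lee_fin mulr_ge0// chi2_density_ge0.
  (* Monotone convergence along intervals exhausting the positive half line. It is used twice, with
     endpoints [1 / (n + 1)] in the variable [x] and their squares in the variable [t], so that the
     two sequences of integrals match term by term. *)
  have F12 (e : nat -> R) : (forall n m, (n <= m)%N -> e m <= e n) ->
    (forall n, 0 < e n) -> (forall x, 0 < x -> exists n, e n <= x) ->
    forall h : R -> R, (forall x, 0 <= h x) -> measurable_fun setT h ->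
    (\int[mu]_(x in `[e i, +oo[) (h x)%:E)%E @[i --> \oo] -->
      (\int[mu]_(x in `]0%R, +oo[) (h x)%:E)%E.
  move=> e_nincr e_gt0 e_small h h0 mh.
  have -> : `]0%R, +oo[%classic = \bigcup_i `[e i, +oo[%classic :> set R.
    apply/seteqP; split => x /=; rewrite in_itv/= andbT.
      by move=> /e_small[n enx]; exists n => //=; rewrite in_itv/= andbT.
    by move=> [n _ /=]; rewrite in_itv/= andbT; apply: lt_le_trans.
  apply: ge0_nondecreasing_set_cvg_integral => //.
  - move=> n m nm; rewrite subsetEset => x /=; rewrite !in_itv/= !andbT.
    by apply: le_trans; exact: e_nincr.
  - by move=> i; apply/measurable_funTS/measurable_EFinP.
  - by move=> i x _; rewrite lee_fin.
have einv n m : (n <= m)%N -> m.+1%:R^-1 <= n.+1%:R^-1 :> R.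
  by move=> nm; rewrite lef_pV2 ?posrE// ler_nat.
have small (x : R) : 0 < x -> exists n, n.+1%:R^-1 <= x.
  move=> x0; have [n _ /(_ n) /= hn] := near_infty_natSinv_lt (PosNum x0).
  by exists n; exact/ltW/hn.
have e_gt0 n : 0 < n.+1%:R^-1 :> R by rewrite invr_gt0.
have G2_ge0 x : 0 <= 2 * G x by rewrite mulr_ge0.
have mG2 : measurable_fun setT (fun x => 2 * G x).
  by apply: measurable_funM => //; exact: continuous_measurable_fun.
have lim1 := F12 _ einv e_gt0 small _ G2_ge0 mG2.
have lim2 : (\int[mu]_(x in `[(i.+1%:R^-1 ^+ 2)%R, +oo[) (K x)%:E)%E @[i --> \oo] -->
      (\int[mu]_(x in `]0%R, +oo[) (K x)%:E)%E.
  apply: (F12 (fun i => i.+1%:R^-1 ^+ 2)) => //.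
  - by move=> n m nm; apply: lerXn2r; rewrite ?nnegrE ?(ltW (e_gt0 _))//; exact: einv.
  - move=> x x0; have [n hn] := small (Num.sqrt x) ltac:(by rewrite sqrtr_gt0).
    exists n; rewrite -(sqr_sqrtr (ltW x0)).
    by apply: lerXn2r => //; rewrite nnegrE ?(ltW (e_gt0 _))// sqrtr_ge0.
apply: (cvg_unique _ lim1); first exact: ereal_hausdorff.
rewrite (_ : (fun i => _) = (fun i =>
  \int[mu]_(x in `[(i.+1%:R^-1 ^+ 2)%R, +oo[) (K x)%:E)%E)//.
apply/funext => n; rewrite (ge0_integral_sqrt_subst (e_gt0 n))//; last first.
  by move=> x; apply: cvgMr; exact: cG.
apply: eq_integral => t; rewrite inE/= in_itv/= andbT => nt.
by rewrite -HK// (lt_le_trans _ nt)// exprn_gt0.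
Qed.
End ChiSquare.

(** * Chi-square laws: adding one degree of freedom *)

Section ChiSquareLaw.
Variable R : realType.
Local Notation mu := (@lebesgue_measure R).
Local Notation gamma := (@normal_prob R 0 1).
Local Notation phi := (@normal_pdf R 0 1).

(* [a] is half the number of degrees of freedom; the normalizing constant is left
   free, being recovered from the total mass. *)
Definition chi2_law d (T : measurableType d) (P : probability T R) (Q : T -> R)
    (a : R) : Prop :=
  exists2 c : \bar R, (0 <= c)%E &
    forall f : R -> R, continuous f -> (forall x, 0 <= f x) ->
    (\int[P]_w (f (Q w))%:E =
     c * \int[mu]_(t in `]0%R, +oo[) (f t * chi2_density a t)%:E)%E.

(** The cut-off removes the nonpositive arguments, at which the value of [powR] is a mere
    convention, and lets the convolution run over the whole line. *)
Let pospow (a s : R) : R := (0 < s)%R%:R * s `^ (a - 1).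

Let pospow_ge0 a s : 0 <= pospow a s.
Proof. by rewrite mulr_ge0 ?powR_ge0. Qed.

Let measurable_pospow a : measurable_fun setT (pospow a).
Proof.
apply: measurable_funM; last exact: measurable_powR.
rewrite (_ : (fun x => _) = \1_(`]0, +oo[%classic : set R)); last first.
  by apply/funext => x; rewrite indicE mem_setE/= in_itv/= andbT.
by apply: measurable_indic; exact: measurable_itv.
Qed.

Let pospowM a t s : 0 < t -> pospow a (t * s) = t `^ (a - 1) * pospow a s.
Proof.
move=> t0; rewrite /pospow pmulr_rgt0//; have [s0|_] := ltP 0 s.
  by rewrite !mul1r powRM// ltW.
by rewrite !mul0r mulr0.
Qed.

(** Homogeneity: [x = sqrt t * y] pulls the power of [t] out. The remaining factor is a Beta
    integral, which is not evaluated. *)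
Let integral_pospow a t : 0 < t ->
  (\int[mu]_x (pospow a (t - x ^+ 2))%:E =
   (t `^ (a - 2^-1))%:E * \int[mu]_x (pospow a (1 - x ^+ 2))%:E)%E.
Proof.
move=> t0; have st0 : 0 < Num.sqrt t by rewrite sqrtr_gt0.
have msub u : measurable_fun setT (fun x : R => pospow a (u - x ^+ 2)).
  apply: (measurableT_comp (measurable_pospow a)).
  by apply: measurable_funB => //; exact: measurable_funX.
have st_neq0 : Num.sqrt t != 0 by rewrite gt_eqF.
have emsub u : measurable_fun setT (fun x : R => (pospow a (u - x ^+ 2))%:E).
  by apply/measurable_EFinP; exact: msub.
have pos u (x : R) : (0 <= (pospow a (u - x ^+ 2))%:E)%E by rewrite lee_fin.
rewrite (ge0_integral_affine 0 st_neq0 (emsub t) (pos t)).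
rewrite (gtr0_norm st0).
transitivity ((Num.sqrt t)%:E *
    \int[mu]_x ((t `^ (a - 1))%:E * (pospow a (1 - x ^+ 2))%:E))%E.
  congr (_ * _)%E; apply: eq_integral => x _; rewrite addr0 exprMn sqr_sqrtr ?ltW//.
  by rewrite -[X in X - _]mulr1 -mulrBr pospowM.
rewrite (ge0_integralZl mu measurableT (emsub 1)); last 2 first.
- by move=> x _; exact: pos.
- by rewrite lee_fin powR_ge0.
rewrite muleA -EFinM; congr (_%:E * _)%E.
by rewrite -powR12_sqrt ?ltW// -powRD; [congr (_ `^ _); field|rewrite (gt_eqF t0) implybT].
Qed.

(** The convolution with the law of a squared normal is homogeneous in [t] up to the exponential, so
    it has the expected shape. Its Beta factor goes into the free constant of [chi2_law]. *)
Lemma chi2_law_add d (T : measurableType d) (P : probability T R) (Q : T -> R) (a : R) :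
  measurable_fun setT Q -> chi2_law P Q a ->
  chi2_law (P \x gamma)%E (fun z => Q z.1 + z.2 ^+ 2) (a + 2^-1).
Proof.
move=> mQ [c c0 QE].
pose C := (Num.sqrt (pi *+ 2))^-1 : R.
have C0 : 0 <= C by rewrite invr_ge0.
exists (c * (C%:E * \int[mu]_x (pospow a (1 - x ^+ 2))%:E))%E.
  by rewrite !mule_ge0//; apply: integral_ge0 => x _; rewrite lee_fin.
move=> f cf f0.
have mf : measurable_fun setT f by exact: continuous_measurable_fun.
pose h x t := f t * (pospow a (t - x ^+ 2) * expR (- ((t - x ^+ 2) / 2))).
have h0 x t : (0 <= (h x t)%:E)%E.
  by rewrite lee_fin; apply: mulr_ge0 => //; apply: mulr_ge0 => //; exact: expR_ge0.
have mh2 : measurable_fun setT (fun z : R * R => (h z.1 z.2)%:E).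
  have md : measurable_fun setT (fun z : R * R => z.2 - z.1 ^+ 2).
    by apply: measurable_funB => //; exact: measurable_funX.
  apply/measurable_EFinP; apply: measurable_funM; first exact: (measurableT_comp mf).
  apply: measurable_funM; first exact: (measurableT_comp (measurable_pospow a)).
  apply: measurableT_comp => //; apply: measurableT_comp => //.
  exact: measurable_funM.
have mh x : measurable_fun setT (fun t => (h x t)%:E).
  exact: (measurable_fun_pair2 x mh2).
(* At fixed [x] the law of [Q] is tested on the translate of [f] by [x ^+ 2], and the translation is
   then moved onto the density. *)
have shift x : (\int[P]_w (f (Q w + x ^+ 2))%:E = c * \int[mu]_t (h x t)%:E)%E.
  rewrite (QE (fun t => f (t + x ^+ 2))).
  - congr (c * _)%E.
    rewrite [RHS](ge0_integral_affine (x ^+ 2) (oner_neq0 R) (mh x) (h0 x)).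
    rewrite normr1 mul1e [LHS]integral_mkcond; apply: eq_integral => t _.
    rewrite patchE /h mul1r addrK /pospow /chi2_density; case: ifPn.
      by rewrite inE/= in_itv/= andbT => ->; rewrite mul1r.
    by rewrite notin_setE/= in_itv/= andbT => /negP/negbTE ->; rewrite !mul0r mulr0.
  - move=> t; apply: continuous_comp; last exact: cf.
    by apply: cvgD; [exact: cvg_id|exact: cvg_cst].
  - by move=> t; exact: f0.
have mfQ : measurable_fun setT (fun z : T * measurableTypeR R => (f (Q z.1 + z.2 ^+ 2))%:E).
  apply/measurable_EFinP; apply: (measurableT_comp mf); apply: measurable_funD.
    exact: (measurableT_comp mQ).
  by apply: measurable_funX; exact: measurable_snd.
have fQ0 (z : T * measurableTypeR R) : (0 <= (f (Q z.1 + z.2 ^+ 2))%:E)%E by rewrite lee_fin.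
rewrite (@fubini_tonelli2 _ _ _ _ _ P gamma _ mfQ fQ0) /fubini_G/=.
under eq_integral => x _ do rewrite shift.
pose J (z : R * R) := (C * f z.2 * expR (- (z.2 / 2)) * pospow a (z.2 - z.1 ^+ 2))%:E.
have mJ : measurable_fun setT J.
  apply/measurable_EFinP; apply: measurable_funM; last first.
    apply: (measurableT_comp (measurable_pospow a)); apply: measurable_funB => //.
    exact: measurable_funX.
  apply: measurable_funM; first by apply: measurable_funM => //; exact: measurableT_comp.
  apply: measurableT_comp => //; apply: measurableT_comp => //.
  exact: measurable_funM.
have Cf0 t : 0 <= C * f t * expR (- (t / 2)).
  by apply: mulr_ge0; [apply: mulr_ge0|exact: expR_ge0].
have J0 z : (0 <= J z)%E by rewrite lee_fin; apply: mulr_ge0.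
have kernel x : (\int[mu]_t (h x t)%:E * (phi x)%:E = \int[mu]_t J (x, t))%E.
  have phi0 : (0 <= (phi x)%:E)%E by rewrite lee_fin normal_pdf_ge0.
  rewrite -(ge0_integralZr mu measurableT (mh x) (fun t _ => h0 x t) phi0).
  apply: eq_integral => t _; rewrite /J -EFinM /h normal_pdf01E -/C /=; congr _%:E.
  (* The exponential of [t - x ^+ 2] and that of the normal density combine into a function of [t]
     alone, which leaves only [pospow] to integrate over [x]. *)
  have -> : expR (- (t / 2)) = expR (- ((t - x ^+ 2) / 2)) * expR (- (x ^+ 2 / 2)).
    by rewrite -expRD; congr expR; field.
  ring.
have inth0 x : (0 <= \int[mu]_t (h x t)%:E)%E by apply: integral_ge0 => t _; exact: h0.
have minth : measurable_fun [set: R] (fun x => (\int[mu]_t (h x t)%:E)%E).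
  apply: (@measurable_fun_fubini_tonelli_F _ _ _ _ _ mu _ mh2).
  by move=> z; exact: h0.
rewrite (ge0_integralZl gamma measurableT minth (fun x _ => inth0 x) c0).
rewrite -[RHS]muleA; congr (_ * _)%E.
rewrite (ge0_integral_normal minth inth0).
under eq_integral => x _ do rewrite kernel.
rewrite (@fubini_tonelli _ _ _ _ _ mu mu _ mJ J0).
set k := (\int[mu]_x (pospow a (1 - x ^+ 2))%:E)%E.
have k0 : (0 <= k)%E by apply: integral_ge0 => x _; rewrite lee_fin.
have mpx t : measurable_fun setT (fun x : R => (pospow a (t - x ^+ 2))%:E).
  apply/measurable_EFinP; apply: (measurableT_comp (measurable_pospow a)).
  by apply: measurable_funB => //; exact: measurable_funX.
have mfc : measurable_fun (`]0%R, +oo[%classic : set (measurableTypeR R))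
    (fun t : measurableTypeR R => (f t * chi2_density (a + 2^-1) t)%:E : \bar R).
  apply/measurable_EFinP/measurable_funTS; apply: measurable_funM => //.
  exact: measurable_chi2_density.
rewrite -(ge0_integralZl mu (measurable_itv _) mfc); last 2 first.
- by move=> t _; rewrite lee_fin; apply: mulr_ge0 => //; exact: chi2_density_ge0.
- by rewrite mule_ge0.
rewrite [RHS]integral_mkcond; apply: eq_integral => t _.
have -> : (\int[mu]_x J (x, t) = (C * f t * expR (- (t / 2)))%:E *
    \int[mu]_x (pospow a (t - x ^+ 2))%:E)%E.
  rewrite -(ge0_integralZl mu measurableT (mpx t)); last 2 first.
  - by move=> x _; rewrite lee_fin.
  - by rewrite lee_fin.
  by apply: eq_integral => x _; rewrite -EFinM.
rewrite patchE; case: ifPn.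
  rewrite inE/= in_itv/= andbT => t0; rewrite (integral_pospow a t0) -/k muleA.
  rewrite [RHS]muleAC; congr (_ * _)%E; rewrite -!EFinM; congr _%:E.
  rewrite /chi2_density; have -> : a + 2^-1 - 1 = a - 2^-1 by field.
  ring.
rewrite notin_setE/= in_itv/= andbT => t0.
rewrite [X in (_ * X)%E](_ : _ = 0%E) ?mule0//; apply: integral0_eq => x _.
rewrite /pospow ltNge (_ : t - x ^+ 2 <= 0) ?mul0r//.
by rewrite subr_le0 (le_trans _ (sqr_ge0 x))// leNgt; exact/negP.
Qed.
End ChiSquareLaw.

(** * Standard normal vectors and Gamma values at half-integers *)

Section StandardNormalVector.
Variable R : realType.
Local Notation mu := (@lebesgue_measure R).
Local Notation gamma := (@normal_prob R 0 1).

Lemma scaled_normal_add d (T : measurableType d) (P : probability T R) (L : T -> R)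
    (s b : R) : 0 <= s -> measurable_fun setT L -> scaled_normal P L s ->
  scaled_normal (P \x gamma)%E (fun z => L z.1 + b * z.2)
    (Num.sqrt (s ^+ 2 + b ^+ 2)).
Proof.
move=> s0 mL Ls f mf f0.
have mfL : measurable_fun setT (fun z : T * measurableTypeR R => f (L z.1 + b * z.2)%R).
  apply: (measurableT_comp mf); apply: measurable_funD.
    exact: (measurableT_comp mL).
  by apply: measurable_funM => //; exact: measurable_snd.
have mfs : measurable_fun setT (fun z : R * measurableTypeR R => f (z.1 + b * z.2)%R).
  apply: (measurableT_comp mf); apply: measurable_funD => //.
  by apply: measurable_funM => //; exact: measurable_snd.
rewrite (@fubini_tonelli1 _ _ _ _ _ P gamma _ mfL (fun z => f0 _)) /fubini_F/=.
rewrite (Ls (fun y => \int[gamma]_x f (y + b * x)%R)%E).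
- exact: ge0_integral_normal_comb0.
- exact: (@measurable_fun_fubini_tonelli_F _ _ _ _ _ gamma _ mfs (fun z => f0 _)).
- by move=> x; apply: integral_ge0 => y _; exact: f0.
Qed.

Lemma chi2_law_sqr d (T : measurableType d) (P : probability T R) :
  chi2_law (P \x gamma)%E (fun z : T * measurableTypeR R => z.2 ^+ 2) (2^-1).
Proof.
exists ((Num.sqrt (pi *+ 2))^-1)%:E; first by rewrite lee_fin invr_ge0.
move=> f cf f0; rewrite -ge0_integral_normal_sqr//.
have mf : measurable_fun setT (fun z : T * measurableTypeR R => (f (z.2 ^+ 2))%:E).
  apply/measurable_EFinP; apply: measurableT_comp.
    exact: continuous_measurable_fun.
  by apply: measurable_funX; exact: measurable_snd.
have fe0 (z : T * measurableTypeR R) : (0 <= (f (z.2 ^+ 2))%:E)%E by rewrite lee_fin.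
rewrite (@fubini_tonelli1 _ _ _ _ _ P gamma _ mf fe0) /fubini_F/=.
rewrite integral_cst//= probability_setT mule1//.
Qed.

(** Built on iterated products with [gamma], starting from a one-point space. The squared norm in
    dimension 0 is the constant 0, whose law has no density, hence the condition [0 < m]. *)
Lemma exists_standard_normal_vector (m : nat) :
  exists (d : measure_display) (T : measurableType d) (P : probability T R)
    (N : 'I_m -> T -> R),
    [/\ forall i, measurable_fun setT (N i),
        forall b : 'I_m -> R, scaled_normal P (fun w => \sum_(i < m) b i * N i w)
          (Num.sqrt (\sum_(i < m) b i ^+ 2)) &
        (0 < m)%N -> chi2_law P (fun w => \sum_(i < m) N i w ^+ 2) (m%:R / 2)].
Proof.
elim: m => [|m [d [T [P [N [mN LN QN]]]]]].
  exists default_measure_display, unit, \d_tt, (fun _ _ => 0); split => //.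
  move=> b f mf f0; rewrite integral_dirac// diracT mul1e !big_ord0 sqrtr0.
  under [RHS]eq_integral do rewrite mul0r.
  by rewrite integral_cst//= probability_setT mule1.
pose N' (i : 'I_m.+1) (z : T * measurableTypeR R) : R :=
  if unlift ord0 i is Some j then N j z.1 else z.2.
have N'0 z : N' ord0 z = z.2 by rewrite /N' unlift_none.
have N'S j z : N' (lift ord0 j) z = N j z.1 by rewrite /N' liftK.
exists _, (T * measurableTypeR R)%type, (P \x gamma)%E, N'; split.
- move=> i; rewrite /N'; case: unliftP => [j _|_]; last exact: measurable_snd.
  exact: (measurableT_comp (mN j)).
- move=> b.
  have -> : (fun w => \sum_(i < m.+1) b i * N' i w) =
      (fun z => \sum_(j < m) b (lift ord0 j) * N j z.1 + b ord0 * z.2).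
    apply/funext => z; rewrite big_ord_recl addrC N'0; congr (_ + _).
    by apply: eq_bigr => j _; rewrite N'S.
  have := @scaled_normal_add _ _ _ _ _ (b ord0) (sqrtr_ge0 _) _ (LN (fun j => b (lift ord0 j))).
  rewrite sqr_sqrtr ?sumr_ge0// => [|j _]; last exact: sqr_ge0.
  rewrite big_ord_recl addrC; apply.
  by apply: measurable_sum => j; exact: measurable_funM.
- move=> _.
  have -> : (fun w => \sum_(i < m.+1) N' i w ^+ 2) =
      (fun z => \sum_(j < m) N j z.1 ^+ 2 + z.2 ^+ 2).
    apply/funext => z; rewrite big_ord_recl addrC N'0; congr (_ + _).
    by apply: eq_bigr => j _; rewrite N'S.
  (* The chi-square induction starts at dimension 1, where the only summand is the coordinate just
     added. *)
  case: m N mN LN QN {N' N'0 N'S} => [|m] N mN LN QN.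
    rewrite mul1r; under eq_fun do rewrite big_ord0 add0r.
    exact: chi2_law_sqr.
  have -> : m.+2%:R / 2 = m.+1%:R / 2 + 2^-1 :> R by rewrite -natr1 mulrDl mul1r.
  have mQ : measurable_fun setT (fun w => \sum_(j < m.+1) N j w ^+ 2).
    by apply: measurable_sum => j; exact: measurable_funX.
  exact: chi2_law_add mQ (QN isT).
Qed.

(** A normalizing constant and a Gamma integral could each be infinite a priori; a product equal to
    1 excludes the values 0 and [+oo] for both. *)
Lemma EFin_mul_eq1 (c x : \bar R) : (0 <= c)%E -> (0 <= x)%E -> (c * x = 1)%E ->
  [/\ x \is a fin_num, 0 < fine x & c = (fine x)^-1%:E].
Proof.
move=> c0 x0 cx.
have cn0 : c != 0%E by apply/eqP => c_0; move: cx; rewrite c_0 mul0e => /eqP; rewrite lt_eqF.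
have xn0 : x != 0%E by apply/eqP => x_0; move: cx; rewrite x_0 mule0 => /eqP; rewrite lt_eqF.
have cp : (0 < c)%E by rewrite lt_def cn0.
have xp : (0 < x)%E by rewrite lt_def xn0.
move: c x {c0 x0 cn0 xn0} cp xp cx => [c| |] [x| |] // cp xp;
  rewrite ?(gt0_muley cp) ?(gt0_mulye xp)// -EFinM => -[cx].
split => //=.
by congr _%:E; rewrite -[LHS]mulr1 -(@divff _ x) ?gt_eqF// mulrA cx mul1r.
Qed.

Local Notation Gint a := (\int[mu]_(t in `]0%R, +oo[) (t `^ (a - 1) * expR (- t))%:E)%E.

Lemma measurable_Gamma_integrand (a : R) :
  measurable_fun setT (fun t : R => t `^ (a - 1) * expR (- t)).
Proof.
apply: measurable_funM; first exact: measurable_powR.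
by apply: measurableT_comp => //; exact: measurableT_comp.
Qed.

Lemma integral_chi2_density (a : R) :
  (\int[mu]_(t in `]0%R, +oo[) (chi2_density a t)%:E = (2 `^ a)%:E * Gint a)%E.
Proof.
have mI : measurable (`]0, +oo[%classic : set R) by exact: measurable_itv.
pose g := (fun t => (chi2_density a t)%:E) \_ (`]0%R, +oo[%classic : set R).
have g0 t : (0 <= g t)%E.
  by apply: erestrict_ge0 => u _; rewrite lee_fin chi2_density_ge0.
have mg : measurable_fun setT g.
  apply/(measurable_restrictT _ mI)/measurable_funTS/measurable_EFinP.
  exact: measurable_chi2_density.
rewrite integral_mkcond.
have two_neq0 : (2 : R) != 0 by [].
rewrite [LHS](ge0_integral_affine 0 two_neq0 mg g0) ger0_norm//.
have mG : measurable_fun (`]0%R, +oo[%classic : set (measurableTypeR R))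
    (fun t : measurableTypeR R => (t `^ (a - 1) * expR (- t))%:E : \bar R).
  by apply/measurable_EFinP/measurable_funTS; exact: measurable_Gamma_integrand.
rewrite -(ge0_integralZl mu (measurable_itv _) mG); last 2 first.
- by move=> t _; rewrite lee_fin mulr_ge0 ?powR_ge0 ?expR_ge0.
- by rewrite lee_fin powR_ge0.
have two_ge0 : (0 <= 2%:E :> \bar R)%E by rewrite lee_fin.
have mg2 : measurable_fun [set: measurableTypeR R] (fun x => g (2 * x + 0)).
  exact: (measurableT_comp mg (measurable_affine 2 0)).
rewrite -(ge0_integralZl mu measurableT mg2 (fun x _ => g0 _) two_ge0).
rewrite [RHS]integral_mkcond; apply: eq_integral => x _.
rewrite /g addr0 !patchE.
have -> : (2 * x \in (`]0%R, +oo[%classic : set R)) = (x \in (`]0%R, +oo[%classic : set R)).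
  by rewrite !mem_setE !in_itv/= !andbT pmulr_rgt0.
case: ifPn => [|_]; last by rewrite mule0.
rewrite inE/= in_itv/= andbT => x0; rewrite -!EFinM; congr _%:E.
rewrite /chi2_density powRM ?ltW// (mulrC 2 x) mulfK// !mulrA; congr (_ * _ * _).
by rewrite -{1}(powRr1 (ltW (ltr0n R 2))) -powRD ?two_neq0 ?implybT//; congr (_ `^ _); ring.
Qed.

Lemma integral_probability_cst d (T : measurableType d) (P : probability T R) (r : R) :
  (\int[P]_w r%:E = r%:E)%E.
Proof. by rewrite integral_cst//= probability_setT mule1. Qed.

(** Testing a chi-square law on the constant 1 gives a product equal to 1 in which the Gamma
    integral is a factor. Its finiteness shows that [fine] loses nothing in the definition of
    [Gamma]. *)
Lemma Gamma_half_fin (m : nat) : (0 < m)%N ->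
  0 < Gamma (m%:R / 2 : R) /\ Gint (m%:R / 2 : R) = (Gamma (m%:R / 2 : R))%:E.
Proof.
move=> m0; have [d [T [P [N [_ _ /(_ m0)[c c0 /(_ (cst 1))]]]]]] :=
  exists_standard_normal_vector m.
move=> /(_ (fun x => @cst_continuous R R 1 x) (fun=> ler01)).
rewrite /= integral_probability_cst; under eq_integral do rewrite mul1r.
rewrite integral_chi2_density => /esym cG.
have G0 : (0 <= Gint (m%:R / 2 : R))%E.
  by apply: integral_ge0 => t _; rewrite lee_fin mulr_ge0 ?powR_ge0 ?expR_ge0.
have c20 : (0 <= c * (2 `^ (m%:R / 2))%:E)%E by rewrite mule_ge0// lee_fin powR_ge0.
rewrite muleA in cG.
have [Gf Gp _] := EFin_mul_eq1 c20 G0 cG.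
by split; [exact: Gp|rewrite fineK].
Qed.

(** A factor [sqrt t ^+ p] only shifts the parameter of the density from [m / 2] to [(m + p) / 2],
    so the moment is a ratio of two total masses. The powers of 2 in these masses leave
    [sqrt 2 ^+ p]. *)
Lemma chi2_law_moment d (T : measurableType d) (P : probability T R) (Q : T -> R)
    (m p : nat) : (0 < m)%N -> chi2_law P Q (m%:R / 2) ->
  (\int[P]_w (Num.sqrt (Q w) ^+ p)%:E =
   (Num.sqrt 2 ^+ p * (Gamma ((m + p)%:R / 2) / Gamma (m%:R / 2 : R)))%:E)%E.
Proof.
move=> m0 [c c0 QE].
have [Gm0 GmE] := Gamma_half_fin m0.
have [Gmp0 GmpE] : 0 < Gamma ((m + p)%:R / 2 : R) /\ _ := Gamma_half_fin (ltn_addr p m0).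
have c1 : (1 = c * (2 `^ (m%:R / 2) * Gamma (m%:R / 2 : R))%:E)%E.
  have := QE (cst 1) (fun x => @cst_continuous R R 1 x) (fun=> ler01).
  rewrite /= integral_probability_cst; under eq_integral do rewrite mul1r.
  by rewrite integral_chi2_density GmE -EFinM.
have J0 : (0 <= (2 `^ (m%:R / 2) * Gamma (m%:R / 2 : R))%:E :> \bar R)%E.
  by rewrite lee_fin mulr_ge0 ?powR_ge0 ?ltW.
have [_ _ cE] := EFin_mul_eq1 c0 J0 (esym c1).
rewrite (QE (fun t => Num.sqrt t ^+ p)); last 2 first.
- move=> t; apply: (@continuous_comp _ _ _ (@Num.sqrt R) (fun x => x ^+ p)).
    exact: sqrt_continuous.
  exact: exprn_continuous.
- by move=> t; rewrite exprn_ge0// sqrtr_ge0.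
have -> : (\int[mu]_(t in `]0%R, +oo[) (Num.sqrt t ^+ p * chi2_density (m%:R / 2) t)%:E =
    \int[mu]_(t in `]0%R, +oo[) (chi2_density ((m + p)%:R / 2) t)%:E)%E.
  apply: eq_integral => t; rewrite inE/= in_itv/= andbT => t0; congr _%:E.
  rewrite /chi2_density mulrA; congr (_ * _).
  rewrite -powR12_sqrt ?ltW// -powR_mulrn ?powR_ge0// -powRrM -powRD ?(gt_eqF t0) ?implybT//.
  by congr (_ `^ _); rewrite natrD; field.
rewrite integral_chi2_density GmpE cE -!EFinM /=; congr _%:E.
rewrite natrD mulrDl powRD ?pnatr_eq0 ?implybT//.
have -> : 2 `^ (p%:R / 2) = Num.sqrt 2 ^+ p :> R.
  by rewrite -powR12_sqrt// -powR_mulrn ?powR_ge0// -powRrM mulrC.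
field; rewrite gt_eqF//= gt_eqF// powR_gt0//.
Qed.
End StandardNormalVector.

(** * Linear forms of a Gaussian vector with diagonal covariance *)

Section GaussianVector.
Variable R : realType.
Local Notation gamma := (@normal_prob R 0 1).

Section ScaledNormal.
Context d (T : measurableType d) (P : probability T R).
Implicit Types (L X Y : T -> R) (s : R).

Lemma scaled_normal_sqr L s :
  scaled_normal P L s -> (\int[P]_w (L w ^+ 2)%:E = (s ^+ 2)%:E)%E.
Proof.
move=> Ls; rewrite (Ls (fun x => (x ^+ 2)%:E)); last 2 first.
- by apply/measurable_EFinP; exact: measurable_funX.
- by move=> x; rewrite lee_fin sqr_ge0.
under eq_integral do rewrite exprMn EFinM.
rewrite ge0_integralZl//=; last 3 first.
- by apply/measurable_EFinP; exact: measurable_funX.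
- by move=> x _; rewrite lee_fin sqr_ge0.
- by rewrite lee_fin sqr_ge0.
by rewrite normal_second_moment mule1.
Qed.

(** Symmetry of the normal law, as the combination with coefficients 0 and -1. *)
Lemma ge0_integral_normalN (f : R -> \bar R) :
  measurable_fun setT f -> (forall x, 0 <= f x)%E ->
  (\int[gamma]_x f (- x)%R = \int[gamma]_x f x)%E.
Proof.
move=> mf f0; have := @ge0_integral_normal_comb0 _ 0 (-1) f (lexx _) mf f0.
rewrite expr0n add0r sqrrN expr1n sqrtr1.
under eq_integral => x _.
  under eq_integral do rewrite mul0r add0r mulN1r.
  over.
rewrite integral_cst//= probability_setT mule1 => E.
by rewrite [LHS]E; apply: eq_integral => x _; rewrite mul1r.
Qed.

(** By symmetry the positive and the negative part have the same integral; the difference is 0 as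
    soon as this integral is finite. *)
Lemma scaled_normal_mean L s :
  scaled_normal P L s -> (\int[P]_w (L w)%:E = 0)%E.
Proof.
move=> Ls.
pose g (x : R) : \bar R := maxe x%:E 0%E.
have mg : measurable_fun setT g by apply: measurable_maxe => //; exact: measurable_cst.
have g0 x : (0 <= g x)%E by rewrite /g le_max lexx orbT.
have mgN : measurable_fun setT (fun x : R => g (- x)) by exact: (measurableT_comp mg).
rewrite integralE.
have -> : (\int[P]_w ((fun w => (L w)%:E)^\+ w) = \int[gamma]_x g (s * x)%R)%E.
  by rewrite -(Ls g mg g0); apply: eq_integral => w _; rewrite funeposE.
have -> : (\int[P]_w ((fun w => (L w)%:E)^\- w) = \int[gamma]_x g (s * x)%R)%E.
  rewrite -[RHS]ge0_integral_normalN//; last exact: measurable_scale.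
  under [RHS]eq_integral do rewrite mulrN.
  rewrite -(Ls (fun x => g (- x)%R) mgN (fun x => g0 _)).
  by apply: eq_integral => w _; rewrite funenegE.
rewrite subee//.
(* The bound [max(y, 0) <= 1 + y ^+ 2] reduces finiteness to the second moment. *)
have Iub : (\int[gamma]_x g (s * x)%R <= \int[gamma]_x ((1 + (s * x) ^+ 2)%:E))%E.
  apply: ge0_le_integral => //.
  - exact: measurable_scale.
  - apply/measurable_EFinP; apply: measurable_funD => //; apply: measurable_funX.
    exact: measurable_funM.
  - move=> x _; rewrite /g ge_max !lee_fin; apply/andP; split; last first.
      by rewrite addr_ge0// sqr_ge0.
    by rewrite -subr_ge0 (_ : _ - _ = (s * x - 2^-1) ^+ 2 + 3 / 4) ?addr_ge0 ?sqr_ge0//; field.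
rewrite ge0_fin_numE ?integral_ge0//; apply: le_lt_trans Iub _.
under eq_integral do rewrite EFinD.
rewrite ge0_integralD//=; last 2 first.
- by move=> x _; rewrite lee_fin sqr_ge0.
- by apply/measurable_EFinP; apply: measurable_funX; exact: measurable_funM.
rewrite -(Ls (fun x => (x ^+ 2)%:E)); last 2 first.
- by apply/measurable_EFinP; exact: measurable_funX.
- by move=> x; rewrite lee_fin sqr_ge0.
by rewrite (scaled_normal_sqr Ls) integral_probability_cst -EFinD ltry.
Qed.

Lemma integrable_mul_sqr X Y : measurable_fun setT X -> measurable_fun setT Y ->
  (\int[P]_w (X w ^+ 2)%:E < +oo)%E -> (\int[P]_w (Y w ^+ 2)%:E < +oo)%E ->
  P.-integrable setT (fun w => (X w * Y w)%:E).
Proof.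
move=> mX mY X2 Y2.
have isq (U : T -> R) : measurable_fun setT U -> (\int[P]_w (U w ^+ 2)%:E < +oo)%E ->
    P.-integrable setT (fun w => (U w ^+ 2)%:E).
  move=> mU U2; apply/integrableP; split.
    by apply/measurable_EFinP; exact: measurable_funX.
  by under eq_integral do rewrite gee0_abs ?lee_fin ?sqr_ge0//.
apply: (le_integrable measurableT _ _ (integrableD measurableT (isq _ mX X2) (isq _ mY Y2))).
  by apply/measurable_EFinP; exact: measurable_funM.
move=> w _; rewrite /= lee_fin (le_trans _ (ler_norm _))//.
rewrite normrM -[X w ^+ 2]real_normK ?num_real// -[Y w ^+ 2]real_normK ?num_real//.
by have := sqr_ge0 (`|X w| - `|Y w|); nra.
Qed.
End ScaledNormal.

Section DiagonalCovariance.
Context d (T : measurableType d) (P : probability T R) (n : nat)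
  (eta : 'I_n -> {RV P >-> R}) (sigma : 'I_n -> R).
Hypothesis heta : centered_gaussian_diag eta sigma.

Lemma gaussian_diag_cov i j :
  (\int[P]_w (eta i w * eta j w)%:E = (if i == j then sigma i ^+ 2 else 0)%:E)%E.
Proof.
have [_ E0 cov] := heta.
rewrite -cov covariance.unlock !E0 expectation.unlock/=.
by apply: eq_integral => w _; rewrite !fctE/= !subr0.
Qed.

Lemma gaussian_diag_sqr_norm :
  (\int[P]_w (\sum_(i < n) eta i w ^+ 2)%:E = (\sum_(i < n) sigma i ^+ 2)%:E)%E.
Proof.
under eq_integral do rewrite -sumEFin.
rewrite ge0_integral_sum//; last 2 first.
- by move=> i; apply/measurable_EFinP; exact: measurable_funX.
- by move=> i w _; rewrite lee_fin sqr_ge0.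
rewrite -sumEFin; apply: eq_bigr => i _.
by under eq_integral do rewrite expr2; rewrite gaussian_diag_cov eqxx.
Qed.

(** The form is almost everywhere a combination of independent standard normals plus a constant, so
    it is normal. The matrix [A] is not compared with the covariance; the standard deviation is
    identified by computing the second moment of the form in two ways. *)
Lemma gaussian_diag_scaled_normal (b : 'I_n -> R) :
  scaled_normal P (fun w => \sum_(i < n) b i * eta i w)
    (Num.sqrt (\sum_(i < n) (b i * sigma i) ^+ 2)).
Proof.
have [[k [Z [A [c [indepZ normalZ etaE]]]]] E0 _] := heta.
pose L (b : 'I_n -> R) w := \sum_(j < k) (\sum_(i < n) b i * A i j) * Z j w.
have mL b' : measurable_fun setT (L b').
  by apply: measurable_sum => j; exact: measurable_funM.
have LN b' := scaled_normal_sum (fun j => \sum_(i < n) b' i * A i j) indepZ normalZ.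
have ae_eq b' (f : R -> \bar R) : measurable_fun setT f -> (forall x, 0 <= f x)%E ->
  (\int[P]_w f (\sum_(i < n) b' i * eta i w)%R =
   \int[P]_w f (L b' w + \sum_(i < n) b' i * c i)%R)%E.
  move=> mf f0; apply: ge0_ae_eq_integral => //.
  - apply: (measurableT_comp mf); apply: measurable_sum => i.
    exact: measurable_funM.
  - by apply: (measurableT_comp mf); exact: measurable_funD.
  - apply: filterS etaE => w wE _; congr f.
    under eq_bigr do rewrite wE mulrDr mulr_sumr.
    rewrite big_split/= exchange_big/=; congr (_ + _); apply: eq_bigr => j _.
    by rewrite mulr_suml; apply: eq_bigr => i _; rewrite mulrA.
(* [eta i] has mean zero by hypothesis and the combination of the [Z j] by symmetry, so the offset
   vanishes. *)
have c0 i : c i = 0.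
  pose M w := \sum_(j < k) A i j * Z j w.
  have mM : measurable_fun setT M.
    by apply: measurable_sum => j; exact: measurable_funM.
  have MN := scaled_normal_sum (A i) indepZ normalZ.
  have iM : P.-integrable setT (EFin \o M).
    have := @integrable_mul_sqr _ _ P M (cst 1) mM.
    rewrite (scaled_normal_sqr MN) ltry /=.
    under eq_integral do rewrite expr1n.
    rewrite integral_probability_cst ltry => /(_ _ isT isT).
    by under eq_fun do rewrite mulr1; apply.
  have := E0 i; rewrite expectation.unlock.
  rewrite (ae_eq_integral (fun w => (M w + c i)%:E))//; last 3 first.
  - exact/measurable_EFinP.
  - by apply/measurable_EFinP; exact: measurable_funD.
  - by apply: filterS etaE => w wE _; rewrite wE.
  under eq_integral do rewrite EFinD.
  rewrite integralD//; last exact: finite_measure_integrable_cst.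
  by rewrite (scaled_normal_mean MN) integral_probability_cst add0e => -[].
have combE (f : R -> \bar R) : measurable_fun setT f -> (forall x, 0 <= f x)%E ->
    (\int[P]_w f (\sum_(i < n) b i * eta i w)%R =
    \int[P]_w f (L b w))%E.
  move=> mf f0; rewrite (ae_eq b f mf f0); apply: eq_integral => w _; congr f.
  by rewrite big1 ?addr0// => i _; rewrite c0 mulr0.
have etaN : scaled_normal P (fun w => \sum_(i < n) b i * eta i w)
    (Num.sqrt (\sum_(j < k) (\sum_(i < n) b i * A i j) ^+ 2)).
  by move=> f mf f0; rewrite combE// LN.
(* Both sides are the second moment of the form: the left one because it is a scaled normal, the
   right one by expanding the square and inserting the covariances. *)
suff <- : \sum_(j < k) (\sum_(i < n) b i * A i j) ^+ 2 =
  \sum_(i < n) (b i * sigma i) ^+ 2 by [].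
have := scaled_normal_sqr etaN.
rewrite sqr_sqrtr ?sumr_ge0// => [sE|j _]; last exact: sqr_ge0.
apply: EFin_inj; rewrite -sE.
have ieta i j : P.-integrable setT (fun w => (eta i w * eta j w)%:E).
  apply: integrable_mul_sqr => //.
    by under eq_integral do rewrite expr2; rewrite gaussian_diag_cov ltry.
  by under eq_integral do rewrite expr2; rewrite gaussian_diag_cov ltry.
transitivity (\int[P]_w (\sum_(i < n) \sum_(j < n)
    (b i * b j)%:E * (eta i w * eta j w)%:E))%E.
  apply: eq_integral => w _; rewrite expr2 mulr_suml -sumEFin.
  apply: eq_bigr => i _; rewrite mulr_sumr -sumEFin; apply: eq_bigr => j _.
  by rewrite -EFinM mulrACA.
rewrite integral_sum//; last first.
  by move=> i; apply: integrable_sum => // j _; exact: integrableZl.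
rewrite -sumEFin; apply: eq_bigr => i _; rewrite integral_sum//; last first.
  by move=> j; exact: integrableZl.
rewrite (bigD1 i)//= integralZl// gaussian_diag_cov eqxx big1 ?adde0.
  by rewrite -EFinM exprMn expr2.
move=> j ji; rewrite integralZl// gaussian_diag_cov eq_sym (negbTE ji) mule0//.
Qed.
End DiagonalCovariance.
End GaussianVector.

(** * Stereographic parametrization of the sphere and its volume density *)

Section Stereographic.
Variables (R : realType) (k : nat).
Implicit Types (u v : 'rV[R]_k) (e : R) (B : 'M[R]_(1 + k)).

Definition sqnorm u : R := \sum_(i < k) u 0 i ^+ 2.

(** The factor by which the differential of [stereo] multiplies lengths at [u], as [dstereo_gram]
    shows. *)
Definition conformal u : R := 2 / (1 + sqnorm u).

(* Inverse stereographic projection from the pole [e * e_0], [e = 1] or [-1]. *)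
Definition stereo e u : 'rV[R]_(1 + k) :=
  row_mx (const_mx e) 0 + conformal u *: row_mx (const_mx (- e)) u.

(** The differential of [stereo], acting on row vectors from the right. The first term comes from
    differentiating [conformal], whose derivative along [v] is [- conformal u ^+ 2] times the
    product of [v] and [u]. *)
Definition dstereo e u : 'M[R]_(k, 1 + k) :=
  - conformal u ^+ 2 *: (u^T *m row_mx (const_mx (- e)) u) +
  conformal u *: row_mx 0 1%:M.

Lemma sqnorm_ge0 u : 0 <= sqnorm u.
Proof. by apply: sumr_ge0 => i _; exact: sqr_ge0. Qed.

Lemma mul_trmx_sqnorm u : u *m u^T = (sqnorm u)%:M.
Proof.
by apply/matrixP => i j; rewrite !ord1 !mxE eqxx mulr1n; apply: eq_bigr => l _; rewrite !mxE expr2.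
Qed.

Lemma sqnorm1_gt0 u : 0 < 1 + sqnorm u.
Proof. by rewrite ltr_pwDl// sqnorm_ge0. Qed.

Lemma conformal_gt0 u : 0 < conformal u.
Proof. by rewrite divr_gt0// sqnorm1_gt0. Qed.

Lemma conformalE u : 1 + sqnorm u = 2 / conformal u.
Proof. by rewrite /conformal; field; rewrite gt_eqF// sqnorm1_gt0. Qed.

Lemma pole_mul e u : e ^+ 2 = 1 ->
  row_mx (const_mx (- e) : 'rV_1) u *m (row_mx (const_mx (- e)) u)^T =
  (2 / conformal u)%:M.
Proof.
move=> e1; rewrite tr_row_mx mul_row_col mul_trmx_sqnorm -conformalE raddfD/=.
congr (_ + _); apply/matrixP => i j.
by rewrite !ord1 !mxE big_ord1 !mxE eqxx mulrNN -expr2 e1.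
Qed.

(** With [c] the conformal factor, the vector [w = (- e, u)] has squared length [2 / c]. The
    coefficient of [u^T *m u] is then [c ^+ 4 * (2 / c) - 2 * c ^+ 3 = 0], and only [c ^+ 2] times
    the identity survives. *)
Lemma dstereo_gram e u : e ^+ 2 = 1 ->
  dstereo e u *m (dstereo e u)^T = (conformal u ^+ 2)%:M.
Proof.
move=> e1; set c := conformal u; set w := row_mx (const_mx (- e) : 'rV_1) u.
have c0 : c != 0 by rewrite gt_eqF// conformal_gt0.
have ww := pole_mul u e1; rewrite -/c -/w in ww.
rewrite /dstereo -/c -/w; clearbody c.
rewrite linearD/= ![(_ *: _)^T]linearZ/= trmx_mul trmxK.
set I0 := row_mx 0 1%:M.
have wI : w *m I0^T = u by rewrite tr_row_mx mul_row_col !trmx0 trmx1 mulmx0 add0r mulmx1.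
have Iw : I0 *m w^T = u^T by rewrite tr_row_mx mul_row_col mul0mx add0r mul1mx.
have II : I0 *m I0^T = 1%:M by rewrite tr_row_mx mul_row_col mul0mx add0r trmx1 mulmx1.
rewrite mulmxDl !mulmxDr -!scalemxAl -!scalemxAr !scalerA.
rewrite mulmxA -(mulmxA u^T w) ww -(mulmxA u^T w) wI (mulmxA I0) Iw II.
rewrite mul_mx_scalar -scalemxAl scalerA addrA.
rewrite -!scalerDl.
rewrite [X in X *: (u^T *m u)](_ : _ = 0) ?scale0r ?add0r ?scalemx1 ?expr2//.
by field.
Qed.

Lemma stereo_sqr e u : e ^+ 2 = 1 -> stereo e u *m (stereo e u)^T = 1%:M.
Proof.
move=> e1; set c := conformal u; set w := row_mx (const_mx (- e) : 'rV_1) u.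
have c0 : c != 0 by rewrite gt_eqF// conformal_gt0.
have ww := pole_mul u e1; rewrite -/c -/w in ww.
pose p : 'rV[R]_(1 + k) := row_mx (const_mx e) 0.
rewrite /stereo -/c -/w -/p; clearbody c.
rewrite linearD/= ![(_ *: _)^T]linearZ/=.
have pp : p *m p^T = 1%:M.
  rewrite tr_row_mx mul_row_col mul0mx addr0; apply/matrixP => i j.
  by rewrite !ord1 !mxE big_ord1 !mxE eqxx -expr2 e1.
have pw : p *m w^T = (-1)%:M.
  rewrite tr_row_mx mul_row_col mul0mx addr0; apply/matrixP => i j.
  by rewrite !ord1 !mxE big_ord1 !mxE eqxx mulrN -expr2 e1.
have wp : w *m p^T = (-1)%:M.
  rewrite tr_row_mx mul_row_col trmx0 mulmx0 addr0; apply/matrixP => i j.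
  by rewrite !ord1 !mxE big_ord1 !mxE eqxx mulNr -expr2 e1.
rewrite mulmxDl !mulmxDr -!scalemxAl -!scalemxAr pp pw wp ww.
rewrite !scale_scalar_mx -!raddfD/=; congr (_%:M).
by field.
Qed.

Lemma stereoE e u : stereo e u =
  row_mx (const_mx (e * (1 - conformal u))) (conformal u *: u).
Proof.
rewrite /stereo scale_row_mx add_row_mx add0r; congr row_mx.
by apply/matrixP => i j; rewrite !mxE mulrBr mulr1 mulrN mulrC.
Qed.

Lemma stereo_inj e u u' : e ^+ 2 = 1 -> stereo e u = stereo e u' -> u = u'.
Proof.
move=> e1; rewrite !stereoE => /eq_row_mx[/matrixP/(_ 0 0)]; rewrite !mxE.
have e0 : e != 0 by rewrite -sqrf_eq0 e1 oner_neq0.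
move=> /(mulfI e0)/addrI/oppr_inj ->; apply: scalerI.
by rewrite gt_eqF// conformal_gt0.
Qed.

Lemma sqnormZ (a : R) u : sqnorm (a *: u) = a ^+ 2 * sqnorm u.
Proof.
by rewrite /sqnorm mulr_sumr; apply: eq_bigr => i _; rewrite mxE exprMn.
Qed.

(** The sign condition selects the closed hemisphere opposite to the pole, which corresponds to the
    closed unit ball. *)
Lemma stereo_onto e (x : 'rV[R]_(1 + k)) : e ^+ 2 = 1 -> x *m x^T = 1%:M ->
  e * lsubmx x 0 0 <= 0 -> exists2 u, sqnorm u <= 1 & stereo e u = x.
Proof.
move=> e1; rewrite -(hsubmxK x); set a := lsubmx x; set b := rsubmx x; clearbody a b.
rewrite row_mxKl tr_row_mx mul_row_col mul_trmx_sqnorm => /matrixP/(_ 0 0).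
rewrite !mxE big_ord1 mxE eqxx mulr1n -expr2; set t := a 0 0 => xx et.
(* The first coordinate of [stereo e u] is [e * (1 - conformal u)], which forces this value of the
   conformal factor and then [u = c^-1 *: b]. *)
pose c := 1 - e * t.
have c1 : 1 <= c by rewrite lerBrDr gerDl.
have c0 : 0 < c by exact: lt_le_trans c1.
have bE : sqnorm b = c * (2 - c).
  have -> : c * (2 - c) = 1 - e ^+ 2 * t ^+ 2 by rewrite /c; ring.
  have {}xx : t ^+ 2 + sqnorm b = 1 by rewrite xx.
  by rewrite e1 mul1r -xx addrC addKr.
have sE : 1 + sqnorm (c^-1 *: b) = 2 / c.
  by rewrite sqnormZ bE; field; rewrite gt_eqF.
have cE : conformal (c^-1 *: b) = c.
  by rewrite /conformal sE; field; rewrite gt_eqF.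
exists (c^-1 *: b).
  by rewrite -(lerD2l 1) sE ler_pdivrMr// -[leLHS]mulr1 ler_pM2l.
rewrite stereoE cE scalerA divff ?gt_eqF// scale1r; congr row_mx.
apply/matrixP => i j; rewrite !ord1 mxE /c -/t.
have -> : e * (1 - (1 - e * t)) = e ^+ 2 * t by ring.
by rewrite e1 mul1r.
Qed.

Lemma stereo_head e u : e ^+ 2 = 1 -> e * lsubmx (stereo e u) 0 0 = 1 - conformal u.
Proof. by move=> e1; rewrite stereoE row_mxKl mxE mulrA -expr2 e1 mul1r. Qed.

Lemma differentiable_rV (V : normedModType R) n (f : V -> 'rV[R]_n) (x : V) :
  (forall j, differentiable (fun z => f z 0 j : R) x) -> differentiable f x.
Proof.
move=> df.
have -> : f = \sum_(j < n) (fun z => f z 0 j *: delta_mx 0 j).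
  by apply/funext => z; rewrite fct_sumE [LHS]row_sum_delta.
by apply: differentiable_sum => j; exact: differentiableZl.
Qed.

Lemma is_derive_coord u v (j : 'I_k) : is_derive u v (fun u => u 0 j : R) (v 0 j).
Proof.
have df := differentiable_coord u 0 j.
apply: DeriveDef; first exact: diff_derivable.
have := derive_mx (@derivable_id _ _ u v); rewrite derive_id => /matrixP/(_ 0 j).
by rewrite mxE => ->.
Qed.

Lemma differentiable_sqnorm u : differentiable sqnorm u.
Proof.
have -> : sqnorm = \sum_(i < k) ((fun u : 'rV[R]_k => u 0 i : R) ^+ 2).
  by apply/funext => w; rewrite fct_sumE.
apply: differentiable_sum => i; apply: differentiableX.
exact: differentiable_coord.
Qed.

Lemma is_derive_sqnorm u v : is_derive u v sqnorm (2 * (v *m u^T) 0 0).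
Proof.
have -> : sqnorm = \sum_(i < k) ((fun u : 'rV[R]_k => u 0 i : R) ^+ 2).
  by apply/funext => w; rewrite fct_sumE.
have -> : 2 * (v *m u^T) 0 0 = \sum_(i < k) (2 * u 0 i ^+ 1 * v 0 i).
  rewrite mxE mulr_sumr; apply: eq_bigr => i _; rewrite mxE expr1; ring.
apply: is_derive_sum => i.
have := is_derive_coord u v i => h.
by apply: is_derive_eq.
Qed.

Lemma differentiable_conformal u : differentiable conformal u.
Proof.
apply: differentiableM => //; apply: differentiableV.
  by apply: differentiableD => //; exact: differentiable_sqnorm.
by rewrite gt_eqF// sqnorm1_gt0.
Qed.

Lemma is_derive_conformal u v :
  is_derive u v conformal (- conformal u ^+ 2 * (v *m u^T) 0 0).
Proof.
have s0 : 1 + sqnorm u != 0 by rewrite gt_eqF// sqnorm1_gt0.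
have h := is_derive_sqnorm u v.
pose g : 'rV[R]_k -> R := cst 1 + sqnorm.
have g0 : g u != 0 by [].
have [dg eg] : is_derive u v g (0 + 2 * (v *m u^T) 0 0) by exact: is_deriveD.
have -> : conformal = 2 *: (fun u => (g u)^-1) by [].
have gE : g u = 1 + sqnorm u by [].
clearbody g.
have dV : derivable (fun u => (g u)^-1) u v by apply: (@derivableV _ _ g).
apply: DeriveDef; first exact: derivableZ.
rewrite (deriveZ 2 dV) (deriveV g0 dg) eg gE add0r /GRing.scale/= gE.
rewrite -[2 *: _]/(2 * _); field.
by rewrite -gE.

Qed.

Lemma pole_coord_differentiable e u i :
  differentiable (fun u => row_mx (const_mx (- e) : 'rV_1) u 0 i : R) u.
Proof.
rewrite (_ : (fun u => _) = fun u : 'rV[R]_k =>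
    match fintype.split i with inl _ => - e | inr j => u 0 j end); last first.
  by apply/funext => w; rewrite mxE; case: splitP => // j _; rewrite mxE.
case: (fintype.split i) => [_|j]; first exact: differentiable_cst.
exact: differentiable_coord.
Qed.

Lemma is_derive_pole_coord e u v i :
  is_derive u v (fun u => row_mx (const_mx (- e) : 'rV_1) u 0 i : R)
    (row_mx (0 : 'rV_1) v 0 i).
Proof.
rewrite (_ : (fun u => _) = fun u : 'rV[R]_k =>
    match fintype.split i with inl _ => - e | inr j => u 0 j end); last first.
  by apply/funext => w; rewrite mxE; case: splitP => // j _; rewrite mxE.
rewrite mxE; case: (fintype.split i) => [j|j]; last exact: is_derive_coord.
by rewrite mxE; exact: is_derive_cst.
Qed.

Lemma stereo_coordE e B u j : (stereo e u *m B) 0 j =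
  \sum_(i < 1 + k) (row_mx (const_mx e : 'rV_1) (0 : 'rV_k) 0 i +
    conformal u * row_mx (const_mx (- e) : 'rV_1) u 0 i) * B i j.
Proof.
rewrite mxE; apply: eq_bigr => i _; congr (_ * _).
by rewrite /stereo mxE [in X in _ + X]mxE.
Qed.

Lemma dstereo_coordE e B v u j : (v *m dstereo e u *m B) 0 j =
  \sum_(i < 1 + k) (- conformal u ^+ 2 * (v *m u^T) 0 0 *
     row_mx (const_mx (- e) : 'rV_1) u 0 i +
    conformal u * row_mx (0 : 'rV_1) v 0 i) * B i j.
Proof.
rewrite mxE; apply: eq_bigr => i _; congr (_ * _).
rewrite /dstereo mulmxDr -!scalemxAr mulmxA [v *m row_mx 0 _]mul_mx_row mulmx0 mulmx1.
rewrite {1}[v *m u^T]mx11_scalar mul_scalar_mx scalerA.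
by rewrite mxE [X in X + _]mxE [X in _ + X]mxE.
Qed.

Lemma stereo_differentiable e B u : differentiable (fun u => stereo e u *m B) u.
Proof.
apply: differentiable_rV => j.
rewrite (_ : (fun u => _) = \sum_(i < 1 + k) (B i j *:
  (cst (row_mx (const_mx e : 'rV_1) (0 : 'rV_k) 0 i : R) +
   conformal * (fun u => row_mx (const_mx (- e) : 'rV_1) u 0 i : R)))); last first.
  apply/funext => w; rewrite fct_sumE stereo_coordE; apply: eq_bigr => i _.
  exact: mulrC.
apply: differentiable_sum => i; apply: differentiableZ; apply: differentiableD => //.
apply: differentiableM; first exact: differentiable_conformal.
exact: pole_coord_differentiable.
Qed.

Lemma derive_stereo e B u v :
  'D_v (fun u => stereo e u *m B) u = v *m dstereo e u *m B.
Proof.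
rewrite derive_mx; last exact/diff_derivable/stereo_differentiable.
apply/matrixP => i j; rewrite mxE ord1 dstereo_coordE.
apply: derive_val.
rewrite (_ : (fun u => _) = \sum_(i < 1 + k) (B i j *:
  (cst (row_mx (const_mx e : 'rV_1) (0 : 'rV_k) 0 i : R) +
   conformal * (fun u => row_mx (const_mx (- e) : 'rV_1) u 0 i : R)))); last first.
  apply/funext => w; rewrite fct_sumE stereo_coordE; apply: eq_bigr => l _.
  exact: mulrC.
apply: is_derive_sum => l.
have h1 := is_derive_conformal u v; have h2 := is_derive_pole_coord e u v l.
have h3 := is_deriveZ (B l j) (is_deriveD
  (is_derive_cst (row_mx (const_mx e : 'rV_1) (0 : 'rV_k) 0 l : R) u v) (is_deriveM h1 h2)).
by apply: (is_derive_eq h3); rewrite /GRing.scale/=; ring.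
Qed.

Lemma jacobian_stereo e B u : 'J (fun u => stereo e u *m B) u = dstereo e u *m B.
Proof.
apply/row_matrixP => i; rewrite !rowE mulmxA -derive_stereo.
by rewrite deriveEjacobian//; exact: stereo_differentiable.
Qed.

Lemma stereo_C1 e B (U : set 'rV[R]_k) : Ck 1 U (fun u => stereo e u *m B).
Proof.
split=> [u _|v u _]; first exact: stereo_differentiable.
have -> : (fun u => 'D_v (fun u => stereo e u *m B) u) =
    (fun u => v *m dstereo e u *m B).
  by apply/funext => w; exact: derive_stereo.
apply: differentiable_continuous; apply: differentiable_rV => j.
rewrite (_ : (fun u => _) = \sum_(i < 1 + k) (B i j *:
  (((- 1) *: (conformal * conformal) * (\sum_(l < k) (v 0 l *: (fun u : 'rV[R]_k => u 0 l : R)))) *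
     (fun u => row_mx (const_mx (- e) : 'rV_1) u 0 i : R) +
   (row_mx (0 : 'rV_1) v 0 i) *: conformal))); last first.
  apply/funext => w; rewrite fct_sumE dstereo_coordE; apply: eq_bigr => i _.
  rewrite !fctE fct_sumE mxE mulrC /GRing.scale/= mulN1r -expr2 (mulrC (row_mx 0 v 0 i)).
  by congr (_ * (_ * _ * _ + _)); apply: eq_bigr => l _; rewrite mxE.
apply: differentiable_sum => i; apply: differentiableZ; apply: differentiableD.
  apply: differentiableM; last exact: pole_coord_differentiable.
  apply: differentiableM.
    by apply: differentiableZ; apply: differentiableM; exact: differentiable_conformal.
  apply: differentiable_sum => l; apply: differentiableZ.
  exact: differentiable_coord.
by apply: differentiableZ; exact: differentiable_conformal.
Qed.

Section Gram.
Variables (e : R) (B g : 'M[R]_(1 + k)).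
Hypotheses (e1 : e ^+ 2 = 1) (BgB : B *m g *m B^T = 1%:M).

Lemma stereo_jacobian_gram u :
  'J (fun u => stereo e u *m B) u *m g *m ('J (fun u => stereo e u *m B) u)^T =
  (conformal u ^+ 2)%:M.
Proof.
rewrite jacobian_stereo trmx_mul -(dstereo_gram u e1).
by rewrite -[X in _ = X *m _]mulmx1 -BgB !mulmxA.
Qed.

Lemma stereo_jacobian_free u : row_free ('J (fun u => stereo e u *m B) u).
Proof.
apply/row_freeP; set J := 'J _ u.
exists ((conformal u ^+ 2)^-1 *: (g *m J^T)).
rewrite -scalemxAr mulmxA stereo_jacobian_gram scale_scalar_mx mulVf//.
by rewrite expf_neq0// gt_eqF// conformal_gt0.
Qed.

(** The Gram matrix is [conformal u ^+ 2] times the identity of size [k]. Neither the frame [B] nor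
    the metric [g] is left in the result. *)
Lemma stereo_density u :
  Num.sqrt (\det ('J (fun u => stereo e u *m B) u *m g *m
    ('J (fun u => stereo e u *m B) u)^T)) = conformal u ^+ k.
Proof.
rewrite stereo_jacobian_gram det_scalar -exprM mulnC exprM sqrtr_sqr ger0_norm//.
by rewrite exprn_ge0// ltW// conformal_gt0.
Qed.

Lemma mul_frame_unit : B \in unitmx.
Proof. by have /mulmx1_unit[] : B *m (g *m B^T) = 1%:M by rewrite mulmxA. Qed.

Lemma stereo_frame_inj : injective (fun u => stereo e u *m B).
Proof.
move=> u u' /(congr1 (mulmx^~ (invmx B))); rewrite !mulmxK ?mul_frame_unit//.
exact: stereo_inj.
Qed.

Lemma stereo_frame_unit_sphere u : unit_sphere g (stereo e u *m B).
Proof.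
rewrite /unit_sphere /= /gnorm trmx_mul !mulmxA -2!(mulmxA (stereo e u)) BgB mulmx1.
by rewrite stereo_sqr// mxE eqxx sqrtr1.
Qed.
End Gram.
End Stereographic.

(** * Measurability on row vectors and bounds for iterated integrals *)

Section BorelVectors.
Variable R : realType.

Lemma continuous_measurable_borelV n (f : 'rV[R]_n -> R) : continuous f ->
  measurable_fun [set: borelV R n] (f : borelV R n -> R).
Proof.
move=> /continuousP cf; apply: (measurability _ (RGenOpens.measurableE R)).
move=> _ [_ [a [b ->] <-]]; rewrite setTI; apply: sub_sigma_algebra.
exact/cf/interval_open.
Qed.

Lemma continuous_measurable_borelV_map n m (f : 'rV[R]_n -> 'rV[R]_m) : continuous f ->
  measurable_fun [set: borelV R n] (f : borelV R n -> borelV R m).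
Proof.
move=> /continuousP cf.
have := @measurability _ _ (borelV R n) (borelV R m) setT f (@open 'rV[R]_m) erefl.
apply; move=> _ [A oA <-]; rewrite setTI; apply: sub_sigma_algebra; exact: cf.
Qed.

Lemma continuous_mulmxr n m (L : 'M[R]_(n, m)) : continuous (fun v : 'rV[R]_n => v *m L).
Proof.
move=> v; apply/differentiable_continuous; apply: differentiable_rV => j.
rewrite (_ : (fun z => _) = \sum_(i < n) (L i j *: (fun v : 'rV[R]_n => v 0 i : R))).
  by apply: differentiable_sum => i; apply: differentiableZ; exact: differentiable_coord.
by apply/funext => w; rewrite fct_sumE mxE; apply: eq_bigr => i _; exact: mulrC.
Qed.

Lemma measurable_mulmxr n m (L : 'M[R]_(n, m)) :
  measurable_fun [set: borelV R n] (fun v : borelV R n => v *m L : borelV R m).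
Proof. by apply: continuous_measurable_borelV_map; exact: continuous_mulmxr. Qed.

Lemma measurable_coord n (i : 'I_n) :
  measurable_fun [set: borelV R n] (fun v : borelV R n => v 0 i : R).
Proof.
apply: continuous_measurable_borelV => v; apply/differentiable_continuous.
exact: differentiable_coord.
Qed.

Lemma measurable_sqnorm n : measurable_fun [set: borelV R n] (@sqnorm R n).
Proof.
apply: continuous_measurable_borelV => v; apply/differentiable_continuous.
exact: differentiable_sqnorm.
Qed.

Import HBNNSimple.

(** The integral of a nonnegative function is a supremum over the simple functions below it, hence
    monotone without measurability. The inner integrals of [integral_rV] can thus be compared as
    they stand. *)
Lemma integral_le_nonmeasurable d (T : measurableType d)
    (mu : {measure set T -> \bar R}) (f1 f2 : T -> \bar R) :
  (forall x, 0 <= f1 x)%E -> (forall x, f1 x <= f2 x)%E ->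
  (\int[mu]_x f1 x <= \int[mu]_x f2 x)%E.
Proof.
move=> f10 f12; have f20 x : (0 <= f2 x)%E by exact: le_trans (f12 x).
rewrite !ge0_integralTE//; apply: ereal_sup_le => _ [h hf <-].
by exists h => // x; exact: le_trans (hf x) _.
Qed.

Lemma integral_rV_ge0 k (f : 'rV[R]_k -> \bar R) :
  (forall u, 0 <= f u)%E -> (0 <= integral_rV f)%E.
Proof.
elim: k f => [|k IH] f f0 /=; first exact: f0.
by apply: integral_ge0 => t _; exact: IH.
Qed.

Lemma integral_rV_le k (f1 f2 : 'rV[R]_k -> \bar R) :
  (forall u, 0 <= f1 u)%E -> (forall u, f1 u <= f2 u)%E ->
  (integral_rV f1 <= integral_rV f2)%E.
Proof.
elim: k f1 f2 => [|k IH] f1 f2 f10 f12 /=; first exact: f12.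
apply: integral_le_nonmeasurable => t; first exact: integral_rV_ge0.
exact: IH.
Qed.

(** Indicators of cubes factor along the iterated integral. They serve as majorant and minorant for
    the mass of the sphere. *)
Lemma integral_rV_box k (c r : R) : 0 <= c -> 0 < r ->
  (integral_rV (fun u : 'rV[R]_k => (c * \prod_(i < k) (\1_(`[- r, r]%classic) (u 0 i)))%:E) =
   (c * (2 * r) ^+ k)%:E)%E.
Proof.
move=> c0 r0; elim: k c c0 => [|k IH] c c0 /=; first by rewrite big_ord0.
have mI : measurable (`[- r, r]%classic : set R) by exact: measurable_itv.
transitivity (\int[@lebesgue_measure R]_t
    ((c * (2 * r) ^+ k)%:E * (\1_(`[- r, r]%classic : set R) t)%:E))%E.
  (* Once the first coordinate is fixed, its indicator is a constant that joins [c]; this is why the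
     statement carries a constant. *)
  apply: eq_integral => t _; rewrite -EFinM mulrAC -IH; last by rewrite mulr_ge0.
  congr (integral_rV _); apply/funext => u; congr _%:E.
  have h0 : row_mx (const_mx t : 'rV_1) u 0 ord0 = t.
    by rewrite mxE; case: splitP => // j _; rewrite mxE.
  have hS i : row_mx (const_mx t : 'rV_1) u 0 (lift ord0 i) = u 0 i.
    rewrite mxE; case: splitP => [j|j].
      by rewrite (ord1 j).
    by rewrite /= /bump leq0n add1n => -[ij]; congr (u 0 _); exact/val_inj.
  by rewrite big_ord_recl mulrA h0; under eq_bigr do rewrite hS.
have m1 : measurable_fun [set: R] (fun t => (\1_(`[- r, r]%classic : set R) t)%:E : \bar R).
  by apply/measurable_EFinP; exact: measurable_indic.
have mur : lebesgue_measure (`[- r, r]%classic : set R) = (2 * r)%:E.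
  rewrite lebesgue_measure_itv/= lte_fin gtrN//.
  by rewrite -EFinB opprK mulr_natl mulr2n.
rewrite (ge0_integralZl (@lebesgue_measure R) measurableT m1); last 2 first.
- by move=> x _; rewrite lee_fin.
- by rewrite lee_fin mulr_ge0// exprn_ge0// mulr_ge0// ltW.
rewrite (integral_indic (@lebesgue_measure R) measurableT mI) setIT.
transitivity ((c * (2 * r) ^+ k)%:E * (2 * r)%:E)%E; last by rewrite -EFinM -mulrA exprSr.
by congr (_ * _)%E; exact: mur.
Qed.
End BorelVectors.

(** * The measure on the Euclidean sphere: finite, nonzero, rotation invariant *)

Section SphereMeasure.
Variables (R : realType) (k : nat) (g : 'M[R]_(1 + k)).
Variable dS : {measure set (borelV R (1 + k)) -> \bar R}.
Hypothesis hdS : induced_volume k g (unit_sphere g) dS.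
Implicit Types (B : 'M[R]_(1 + k)) (E : set (borelV R (1 + k))).

(** [v *m invmx B] is the vector of coordinates of [v] in the rows of [B]; for an orthonormal frame
    it takes the unit sphere of [g] to the Euclidean one. *)
Definition frame_measure B : {measure set (borelV R (1 + k)) -> \bar R} :=
  image_measure dS (measurable_mulmxr (invmx B)).

Let sphere : set (borelV R (1 + k)) := [set x | sqnorm x = 1].

(** The closed unit ball already parametrizes a hemisphere; the radius 2 leaves a margin, so that
    the domain is open. *)
Let U : set 'rV[R]_k := [set u | sqnorm u < 4].

Let measurable_sphere : measurable sphere.
Proof.
rewrite -[X in measurable X]setTI.
exact: (@measurable_sqnorm R (1 + k) measurableT [set 1] (measurable_set1 1)).
Qed.

Let cap (e : R) : set (borelV R (1 + k)) :=
  sphere `&` [set x | e * lsubmx (x : 'rV[R]_(1 + k)) 0 0 <= 0].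

Let measurable_cap e : measurable (cap e).
Proof.
apply: measurableI => //; rewrite -[X in measurable X]setTI.
have mh : measurable_fun [set: borelV R (1 + k)]
    (fun x : borelV R (1 + k) => e * lsubmx (x : 'rV[R]_(1 + k)) 0 0).
  apply: measurable_funM => //; under eq_fun do rewrite mxE.
  exact: measurable_coord.
have -> : [set x : borelV R (1 + k) | e * lsubmx (x : 'rV[R]_(1 + k)) 0 0 <= 0] =
  (fun x : borelV R (1 + k) => e * lsubmx (x : 'rV[R]_(1 + k)) 0 0) @^-1` `]-oo, 0].
  by apply/seteqP; split => x /=; rewrite in_itv.
exact: mh.
Qed.

Let sphereE (x : 'rV[R]_(1 + k)) : sphere x <-> x *m x^T = 1%:M.
Proof.
rewrite mul_trmx_sqnorm /sphere /=; split=> [->//|/matrixP/(_ 0 0)].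
by rewrite !mxE eqxx.
Qed.

Let open_U : open U.
Proof.
rewrite (_ : U = @sqnorm R k @^-1` [set x | x < 4]) //.
apply: open_comp; last exact: open_lt.
by move=> u _; apply/differentiable_continuous; exact: differentiable_sqnorm.
Qed.

Section Frame.
Variable B : 'M[R]_(1 + k).
Hypothesis BgB : B *m g *m B^T = 1%:M.

(** [stereo e] followed by [B] is an admissible parametrization, and passing to coordinates in [B]
    undoes [B]. The right-hand side is therefore free of [B]. *)
Lemma frame_measure_patch e E : e ^+ 2 = 1 -> measurable E ->
  E `<=` stereo e @` U ->
  frame_measure B E =
  integral_rV (fun u => (\1_(U `&` stereo e @^-1` E) u * conformal u ^+ k)%:E).
Proof.
move=> e1 mE sEU; rewrite /frame_measure image_measureE.
have Bu := mul_frame_unit BgB.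
have [_ vol] := hdS.
rewrite (vol U (fun u => stereo e u *m B)) //.
- congr (integral_rV _); apply/funext => u.
  rewrite (stereo_density e1 BgB) (_ : _ @^-1` (_ @^-1` E) = stereo e @^-1` E)//.
  by apply/seteqP; split => w /=; rewrite mulmxK.
- exact: stereo_C1.
- by move=> u u' _ _; exact: (stereo_frame_inj e1 BgB).
- by move=> u _; exact: (stereo_jacobian_free e1 BgB).
- by move=> _ [u _ <-]; exact: (stereo_frame_unit_sphere e1 BgB).
- by rewrite -[X in measurable X]setTI; exact: measurable_mulmxr.
- move=> v /= /sEU[u Uu uE]; exists u => //=.
  by rewrite uE mulmxKV.
Qed.

Lemma frame_measure_sphereC : frame_measure B (~` sphere) = 0%E.
Proof.
rewrite /frame_measure image_measureE; have [<- _] := hdS; congr (dS _).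
rewrite -preimage_setC; congr (~` _); apply/seteqP.
have Bu := mul_frame_unit BgB.
have gE : g = invmx B *m (invmx B)^T.
  have : invmx B *m (B *m g *m B^T) *m (invmx B)^T = invmx B *m 1%:M *m (invmx B)^T.
    by rewrite BgB.
  rewrite !mulmxA mulVmx// mul1mx mulmx1 -mulmxA -trmx_mul mulVmx// trmx1 mulmx1.
  by [].
have H v : (v *m invmx B) *m (v *m invmx B)^T = v *m g *m v^T.
  by rewrite trmx_mul gE !mulmxA.
split => v /=.
  move/sphereE; rewrite H /unit_sphere/= /gnorm => ->.
  by rewrite mxE eqxx sqrtr1.
rewrite /unit_sphere/= /gnorm => /(congr1 (fun x => x ^+ 2)).
rewrite expr1n => vv; apply/sphereE; rewrite H.
apply/matrixP => i j; rewrite !ord1 [in RHS]mxE eqxx mulr1n -vv sqr_sqrtr//.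
by rewrite -H mul_trmx_sqnorm mxE eqxx mulr1n sqnorm_ge0.
Qed.

Lemma cap_stereo e : e ^+ 2 = 1 -> cap e `<=` stereo e @` U.
Proof.
move=> e1 x [/sphereE xx /= ex]; have [u u1 uE] := stereo_onto e1 xx ex.
by exists u => //; rewrite /U /= (le_lt_trans u1)// ltr1n.
Qed.

(** The two hemispheres cover the sphere. Removing the first from the second discards the common
    equator, so that each piece lies in one chart and nothing is counted twice. *)
Lemma frame_measure_split E : measurable E ->
  (frame_measure B E = frame_measure B (E `&` cap 1) +
   frame_measure B (E `&` (cap (-1) `\` cap 1)))%E.
Proof.
move=> mE.
have mD : measurable (E `&` (cap (-1) `\` cap 1)).
  by apply: measurableI => //; exact: measurableD.
have mS : measurable (E `\` sphere) by exact: measurableD.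
have EU : E = ((E `&` cap 1) `|` (E `&` (cap (-1) `\` cap 1))) `|` (E `\` sphere).
  apply/seteqP; split => [x Ex|x [[[]//|[]//]|[]//]].
  have [Sx|Sx] := pselect (sphere x); last by right.
  left; have [x0|x0] := pselect (cap 1 x); [by left|right; split => //; split => //].
  split => //=; rewrite mulN1r oppr_le0 leNgt; apply/negP => x_lt0; apply: x0.
  by split => //=; rewrite mul1r ltW.
rewrite [in LHS]EU measureU//; last 2 first.
- by apply: measurableU => //; exact: measurableI.
- by rewrite -subset0 => x [[[_ [? _]]|[_ [[? _] _]]] [_]].
rewrite measureU//; last 2 first.
- exact: measurableI.
- by rewrite -subset0 => x [[_ ?] [_ [_]]].
rewrite [X in (_ + X)%E = _](_ : _ = 0%E) ?adde0//.
apply/eqP; rewrite eq_le measure_ge0 andbT -frame_measure_sphereC.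
apply: le_measure; rewrite ?inE//; exact: measurableC.
Qed.

Let sub_capl E : E `&` cap 1 `<=` stereo 1 @` U.
Proof. by move=> x [_ x1]; apply: cap_stereo => //; rewrite expr1n. Qed.

Let sub_capr E : E `&` (cap (-1) `\` cap 1) `<=` stereo (-1) @` U.
Proof. by move=> x [_ [x1 _]]; apply: cap_stereo => //; rewrite sqrrN expr1n. Qed.

Let sqr1 : (1 : R) ^+ 2 = 1. Proof. exact: expr1n. Qed.
Let sqrN1 : (- 1 : R) ^+ 2 = 1. Proof. by rewrite sqrrN expr1n. Qed.

Let measurable_capr E : measurable E -> measurable (E `&` (cap (-1) `\` cap 1)).
Proof. by move=> mE; apply: measurableI => //; exact: measurableD. Qed.

Lemma frame_measure_fin : (frame_measure B setT < +oo)%E.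
Proof.
have ub e E : e ^+ 2 = 1 -> measurable E -> E `<=` stereo e @` U ->
    (frame_measure B E < +oo)%E.
  move=> e1 mE sE; rewrite (frame_measure_patch e1 mE sE).
  have two0 : (0 : R) < 2 by [].
  have box := integral_rV_box k (exprn_ge0 k (ltW two0)) two0.
  (* The conformal factor is at most 2, and [U] lies in the cube of half-side 2. *)
  apply: (@le_lt_trans _ _ (2 ^+ k * (2 * 2) ^+ k)%:E); last exact: ltry.
  rewrite -box; apply: integral_rV_le => u; rewrite lee_fin.
    by rewrite mulr_ge0 ?exprn_ge0// ltW// conformal_gt0.
  rewrite indicE; have [/set_mem[Uu _]|_] := boolP (u \in _); last first.
    by rewrite mul0r mulr_ge0 ?exprn_ge0// prodr_ge0.
  rewrite mul1r big1 ?mulr1.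
    apply: lerXn2r; rewrite ?nnegrE//; first exact/ltW/conformal_gt0.
    by rewrite /conformal ler_pdivrMr ?sqnorm1_gt0// ler_pMr// lerDl sqnorm_ge0.
  move=> i _; rewrite indicE mem_set//= in_itv/= -ler_norml.
  rewrite -(ler_pXn2r (_ : 0 < 2)%N) ?nnegrE// real_normK ?num_real//.
  apply: le_trans (_ : sqnorm u <= _); last by rewrite (le_trans (ltW Uu))// -natrX.
  by rewrite /sqnorm (bigD1 i)//= lerDl sumr_ge0// => l _; exact: sqr_ge0.
rewrite frame_measure_split// lte_add_pinfty//.
  by apply: (ub 1) => //; exact: measurableI.
by apply: (ub (-1)) => //; exact: measurable_capr.
Qed.

Lemma frame_measure_gt0 : (0 < frame_measure B setT)%E.
Proof.
have m1 : measurable (setT `&` cap 1) by exact: measurableI.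
apply: (@lt_le_trans _ _ (frame_measure B (setT `&` cap 1))); last first.
  by apply: le_measure; rewrite ?inE.
rewrite (frame_measure_patch sqr1 m1 (@sub_capl _)).
(* The cube of half-side [r] lies in the unit ball because [k / (k + 1) ^+ 2 <= 1], and there the
   conformal factor is at least 1. The denominator [k + 1] also covers [k = 0]. *)
pose r : R := k.+1%:R^-1.
have r0 : 0 < r by rewrite invr_gt0.
have box := integral_rV_box k ler01 r0.
apply: (@lt_le_trans _ _ (1 * (2 * r) ^+ k)%:E).
  by rewrite lte_fin mul1r exprn_gt0// mulr_gt0.
rewrite -box; apply: integral_rV_le => u; rewrite lee_fin mul1r.
  by apply: prodr_ge0.
have [ur|ur] := pselect (forall i, `|u 0 i| <= r); last first.
  have [i ui] : exists i, ~ (`|u 0 i| <= r) by apply/existsNP.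
  rewrite (bigD1 i)//= indicE memNset ?mul0r; last by rewrite /= in_itv/= -ler_norml.
  by rewrite mulr_ge0 ?exprn_ge0// ltW// conformal_gt0.
have u1 : sqnorm u <= 1.
  apply: (@le_trans _ _ (\sum_(i < k) r ^+ 2)).
    apply: ler_sum => i _; rewrite -real_normK ?num_real//.
    by apply: lerXn2r; rewrite ?nnegrE ?(ltW r0)//.
  rewrite sumr_const card_ord -mulr_natl /r exprVn -(@ler_pM2r _ (k.+1%:R ^+ 2)) ?exprn_gt0//.
  rewrite mulfVK ?expf_neq0// mul1r -natrX ler_nat expnS expn1.
  by apply: leq_trans (leqnSn k) _; rewrite leq_pmulr.
have c1 : 1 <= conformal u.
  by rewrite /conformal ler_pdivlMr ?sqnorm1_gt0// mul1r -[leRHS]/(1 + 1) lerD2l.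
rewrite indicE mem_set ?mul1r; last first.
  split => /=; first by rewrite /U /= (le_lt_trans u1)// ltr1n.
  split => //; split; first by apply/sphereE; exact: stereo_sqr.
  by rewrite /= stereo_head// subr_le0.
apply: le_trans (exprn_ege1 k c1); apply: prodr_ile1 => i _.
by rewrite ler0n lern1 leq_b1.
Qed.
End Frame.

(** On each of the two pieces both measures are given by the same integral. *)
Lemma frame_measure_indep B B' E : B *m g *m B^T = 1%:M -> B' *m g *m B'^T = 1%:M ->
  measurable E -> frame_measure B E = frame_measure B' E.
Proof.
move=> BgB BgB' mE; rewrite (frame_measure_split BgB mE) (frame_measure_split BgB' mE).
have m1 : measurable (E `&` cap 1) by exact: measurableI.
have m2 : measurable (E `&` (cap (-1) `\` cap 1)).
  by apply: measurableI => //; exact: measurableD.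
have e1 : (1 : R) ^+ 2 = 1 by exact: expr1n.
have eN1 : (- 1 : R) ^+ 2 = 1 by rewrite sqrrN expr1n.
have s1 : E `&` cap 1 `<=` stereo 1 @` U by move=> x [_ x1]; exact: cap_stereo.
have s2 : E `&` (cap (-1) `\` cap 1) `<=` stereo (-1) @` U.
  by move=> x [_ [x1 _]]; exact: cap_stereo.
rewrite (frame_measure_patch BgB e1 m1 s1) (frame_measure_patch BgB' e1 m1 s1).
by rewrite (frame_measure_patch BgB eN1 m2 s2) (frame_measure_patch BgB' eN1 m2 s2).
Qed.

(** Applying [Q] to coordinates in the frame [B] gives coordinates in [Q^T *m B], which is again
    orthonormal; invariance is thus independence of the frame. *)
Lemma frame_measure_rotate B (Q : 'M[R]_(1 + k)) (f : borelV R (1 + k) -> \bar R) :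
  B *m g *m B^T = 1%:M -> Q *m Q^T = 1%:M ->
  measurable_fun setT f -> (forall x, 0 <= f x)%E ->
  (\int[frame_measure B]_x f x = \int[frame_measure B]_x f (x *m Q))%E.
Proof.
move=> BgB QQ mf f0.
rewrite -(ge0_integral_image_measure _ (measurable_mulmxr Q))//.
apply: eq_measure_integral => E mE _; rewrite image_measureE.
have QQ' : Q^T *m Q = 1%:M by exact: mulmx1C.
have BgB' : (Q^T *m B) *m g *m (Q^T *m B)^T = 1%:M.
  by rewrite trmx_mul trmxK !mulmxA -2!(mulmxA Q^T) BgB mulmx1.
transitivity (frame_measure (Q^T *m B) E); first exact: frame_measure_indep.
have Bu := mul_frame_unit BgB; have Bu' := mul_frame_unit BgB'.
have invE : invmx (Q^T *m B) = invmx B *m Q.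
  apply: (can_inj (mulKmx Bu')); rewrite mulmxV//.
  by rewrite !mulmxA mulmxK.
rewrite -[LHS]/(dS [set v | E (v *m invmx (Q^T *m B))]).
rewrite -[RHS]/(dS [set v | E (v *m invmx B *m Q)]).
by rewrite invE; congr (dS _); apply/seteqP; split => v /=; rewrite mulmxA.
Qed.
End SphereMeasure.

(** * Averaging a random linear form over the sphere and over a Gaussian vector *)

Section GaussianAverage.
Variables (R : realType) (k : nat).
Local Notation gamma := (@normal_prob R 0 1).

(* The reflection exchanging [a] and [|a| e_0]. *)
Lemma exists_rotation (a : 'rV[R]_(1 + k)) :
  exists2 Q : 'M[R]_(1 + k), Q *m Q^T = 1%:M &
    forall x : 'rV[R]_(1 + k), (x *m Q *m a^T) 0 0 = Num.sqrt (sqnorm a) * x 0 0.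
Proof.
set r := Num.sqrt (sqnorm a).
have r2 : r ^+ 2 = sqnorm a by rewrite sqr_sqrtr// sqnorm_ge0.
pose e : 'rV[R]_(1 + k) := delta_mx 0 0.
have ee : e *m e^T = 1%:M.
  by rewrite trmx_delta mul_delta_mx; apply/matrixP => i j; rewrite !ord1 !mxE.
have ae : a *m e^T = (a 0 0)%:M.
  by rewrite trmx_delta -colE; apply/matrixP => i j; rewrite !ord1 !mxE eqxx mulr1n.
have ea : e *m a^T = (a 0 0)%:M by rewrite -[LHS]trmxK trmx_mul trmxK ae tr_scalar_mx.
have aa : a *m a^T = (r ^+ 2)%:M by rewrite mul_trmx_sqnorm r2.
pose z := a - r *: e.
suff [Q QQ Qa] : exists2 Q : 'M[R]_(1 + k), Q *m Q^T = 1%:M & Q *m a^T = r *: e^T.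
  exists Q => // x; rewrite -mulmxA Qa -scalemxAr mxE; congr (_ * _).
  by rewrite trmx_delta -colE mxE.
(* If [z = 0] then [a] already lies along [e], and the reflection, which would divide by zero, is
   replaced by the identity. *)
have [z0|z0] := eqVneq (sqnorm z) 0.
  exists 1%:M; first by rewrite trmx1 mulmx1.
  rewrite mul1mx -linearZ/=; congr (_^T); apply/eqP; rewrite -subr_eq0 -/z; apply/eqP.
  apply/rowP => i; rewrite [RHS]mxE; apply/eqP; rewrite -sqrf_eq0.
  move/eqP: z0; rewrite psumr_eq0// => [/allP/(_ i)|j _].
    by apply; rewrite mem_index_enum.
  exact: sqr_ge0.
(* Since [a] and [r *: e] have the same length, the product of [a] with their difference [z] is half
   the square of [z]; the reflection therefore subtracts exactly [z] from [a]. *)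
have za : z *m a^T = (sqnorm z / 2)%:M.
  have -> : sqnorm z = 2 * (r ^+ 2 - r * a 0 0).
    have := mul_trmx_sqnorm z.
    rewrite /z [(_ - _)^T]linearB/= [(_ *: _)^T]linearZ/= mulmxBl !mulmxBr
      -!scalemxAl -!scalemxAr aa ae ea ee.
    move=> /matrixP/(_ 0 0); rewrite !mxE !eqxx !mulr1n => <-; ring.
  rewrite /z mulmxBl -scalemxAl aa ea scale_scalar_mx -raddfB/=; congr (_%:M).
  by field.
have zT : z^T = a^T - r *: e^T by rewrite /z linearB/= linearZ.
clearbody z; exists (1%:M - (2 / sqnorm z) *: (z^T *m z)).
  rewrite [(_ - _)^T]linearB/= [(_ *: _)^T]linearZ/= trmx1 trmx_mul trmxK
    mulmxBl !mulmxBr !(mul1mx, mulmx1).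
  rewrite -scalemxAl -scalemxAr scalerA mulmxA -(mulmxA z^T z) mul_trmx_sqnorm.
  rewrite mul_mx_scalar -scalemxAl scalerA.
  rewrite (_ : 2 / sqnorm z * (2 / sqnorm z) * sqnorm z = 2 / sqnorm z + 2 / sqnorm z).
    by rewrite scalerDl opprB addrK subrK.
  by field.
rewrite mulmxBl mul1mx -scalemxAl -mulmxA za mul_mx_scalar scalerA.
rewrite (_ : 2 / sqnorm z * (sqnorm z / 2) = 1) ?scale1r; last by field.
by rewrite zT opprB addrC subrK.
Qed.

Lemma measurable_linear_form d (T : measurableType d) n p (X Y : 'I_n -> T -> R) :
  (forall i, measurable_fun setT (X i)) -> (forall i, measurable_fun setT (Y i)) ->
  measurable_fun setT (fun t => (`|\sum_(i < n) X i t * Y i t| ^+ p)%:E).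
Proof.
move=> mX mY; apply/measurable_EFinP; apply: measurable_funX.
apply: measurableT_comp => //; apply: measurable_sum => i.
exact: measurable_funM.
Qed.

Section RotationInvariant.
Variable mu : {finite_measure set (borelV R (1 + k)) -> \bar R}.
Hypothesis rot : forall (Q : 'M[R]_(1 + k)) (f : borelV R (1 + k) -> \bar R),
  Q *m Q^T = 1%:M -> measurable_fun setT f -> (forall x, 0 <= f x)%E ->
  (\int[mu]_x f x = \int[mu]_x f (x *m Q))%E.
Variable p : nat.

Let cmu : \bar R := (\int[mu]_x (`|(x : 'rV[R]_(1 + k)) 0 0| ^+ p)%:E)%E.
Let cgamma : \bar R := (\int[gamma]_y (`|y| ^+ p)%:E)%E.

Lemma rotation_invariant_form (a : 'rV[R]_(1 + k)) :
  (\int[mu]_x (`|\sum_(i < 1 + k) (x : 'rV[R]_(1 + k)) 0 i * a 0 i| ^+ p)%:E =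
   (Num.sqrt (sqnorm a) ^+ p)%:E * cmu)%E.
Proof.
have [Q QQ Qa] := exists_rotation a.
rewrite (rot QQ); last 2 first.
- by apply: measurable_linear_form => i //; exact: measurable_coord.
- by move=> x; rewrite lee_fin exprn_ge0.
have mc : measurable_fun [set: borelV R (1 + k)]
    (fun x : borelV R (1 + k) => (`|(x : 'rV[R]_(1 + k)) 0 0| ^+ p)%:E).
  apply/measurable_EFinP; apply: measurable_funX; apply: measurableT_comp => //.
  exact: measurable_coord.
rewrite -(ge0_integralZl mu measurableT mc); last 2 first.
- by move=> x _; rewrite lee_fin exprn_ge0.
- by rewrite lee_fin exprn_ge0// sqrtr_ge0.
apply: eq_integral => x _; rewrite -EFinM -exprMn; congr ((_ ^+ p)%:E).
rewrite -[X in X * _](ger0_norm (sqrtr_ge0 (sqnorm a))) -normrM -Qa mxE.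
by congr (`| _ |); apply: eq_bigr => i _; rewrite [a^T _ _]mxE.
Qed.

Section Average.
Context d (T : measurableType d) (P : probability T R) (n : nat)
  (eta : 'I_n -> T -> R) (sigma : 'I_n -> R).
Hypothesis le_n : (n <= 1 + k)%N.
Hypothesis meta : forall i, measurable_fun setT (eta i).
Hypothesis etaN : forall b : 'I_n -> R,
  scaled_normal P (fun w => \sum_(i < n) b i * eta i w)
    (Num.sqrt (\sum_(i < n) (b i * sigma i) ^+ 2)).

(** Extension by zeros, which makes a form in the first [n] coordinates an instance of
    [rotation_invariant_form]. *)
Let pad (y : 'I_n -> R) : 'rV[R]_(1 + k) :=
  \row_i \sum_(j < n) y j * (widen_ord le_n j == i)%:R.

Let pad_form y (x : 'rV[R]_(1 + k)) :
  \sum_(i < 1 + k) x 0 i * pad y 0 i = \sum_(j < n) x 0 (widen_ord le_n j) * y j.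
Proof.
under eq_bigr do rewrite mxE mulr_sumr.
rewrite exchange_big/=; apply: eq_bigr => j _.
rewrite (bigD1 (widen_ord le_n j))//= eqxx mulr1 big1 ?addr0// => i.
by rewrite eq_sym => /negbTE ->; rewrite !mulr0.
Qed.

Let pad_sqnorm y : sqnorm (pad y) = \sum_(j < n) y j ^+ 2.
Proof.
rewrite /sqnorm; under eq_bigr do rewrite expr2.
rewrite pad_form; apply: eq_bigr => j _; rewrite mxE (bigD1 j)//= eqxx mulr1.
rewrite big1 ?addr0 ?expr2// => l lj; rewrite (_ : (_ == _) = false) ?mulr0//.
by apply/negbTE; apply: contra lj => /eqP/(congr1 val)/= /val_inj ->.
Qed.

(** The constants stay as factors on both sides, since at this point either could be infinite and no
    division is available. *)
Lemma gaussian_sphere_average :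
  (cgamma * \int[mu]_x (Num.sqrt (\sum_(j < n)
      ((x : 'rV[R]_(1 + k)) 0 (widen_ord le_n j) * sigma j) ^+ 2) ^+ p)%:E =
   cmu * \int[P]_w (Num.sqrt (\sum_(j < n) eta j w ^+ 2) ^+ p)%:E)%E.
Proof.
pose F (z : borelV R (1 + k) * T) : \bar R :=
  (`|\sum_(j < n) (z.1 : 'rV[R]_(1 + k)) 0 (widen_ord le_n j) * eta j z.2| ^+ p)%:E.
have mF : measurable_fun setT F.
  apply: (@measurable_linear_form _ (borelV R (1 + k) * T)%type n p
    (fun j z => (z.1 : 'rV[R]_(1 + k)) 0 (widen_ord le_n j)) (fun j z => eta j z.2)) => j.
    exact: (measurableT_comp (measurable_coord (widen_ord le_n j)) measurable_fst).
  exact: (measurableT_comp (meta j) measurable_snd).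
have F0 z : (0 <= F z)%E by rewrite lee_fin exprn_ge0.
have FT := @fubini_tonelli _ _ _ _ _ mu P _ mF F0.
have mpow : measurable_fun [set: R] (fun x => (`|x| ^+ p)%:E).
  by apply/measurable_EFinP; apply: measurable_funX; exact: normr_measurable.
have pow0 (x : R) : (0 <= (`|x| ^+ p)%:E)%E by rewrite lee_fin exprn_ge0.
pose s (x : borelV R (1 + k)) := Num.sqrt (\sum_(j < n)
  ((x : 'rV[R]_(1 + k)) 0 (widen_ord le_n j) * sigma j) ^+ 2).
have s0 x : 0 <= s x by exact: sqrtr_ge0.
have innerP x : (\int[P]_w F (x, w) = cgamma * (s x ^+ p)%:E)%E.
  have := etaN (fun j => (x : 'rV[R]_(1 + k)) 0 (widen_ord le_n j)) mpow pow0.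
  move=> E; rewrite [LHS]E -/(s x).
  rewrite muleC -(ge0_integralZl gamma measurableT mpow); last 2 first.
  - by move=> y _.
  - by rewrite lee_fin exprn_ge0.
  by apply: eq_integral => y _; rewrite normrM exprMn EFinM (ger0_norm (s0 x)).
have innermu w : (\int[mu]_x F (x, w) =
    cmu * (Num.sqrt (\sum_(j < n) eta j w ^+ 2) ^+ p)%:E)%E.
  rewrite muleC -pad_sqnorm -(rotation_invariant_form (pad (fun j => eta j w))).
  by apply: eq_integral => x _; rewrite pad_form.
have msq : measurable_fun setT (@Num.sqrt R : R -> R).
  by apply: continuous_measurable_fun; exact: sqrt_continuous.
have ms : measurable_fun setT (fun x => (s x ^+ p)%:E).
  apply/measurable_EFinP; apply: measurable_funX; apply: (measurableT_comp msq).
  apply: measurable_sum => j; apply: measurable_funX; apply: measurable_funM => //.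
  exact: measurable_coord.
have meq : measurable_fun setT (fun w => (Num.sqrt (\sum_(j < n) eta j w ^+ 2) ^+ p)%:E).
  apply/measurable_EFinP; apply: measurable_funX; apply: (measurableT_comp msq).
  by apply: measurable_sum => j; exact: measurable_funX.
have cg0 : (0 <= cgamma)%E by apply: integral_ge0 => y _.
have cm0 : (0 <= cmu)%E by apply: integral_ge0 => x _; exact: pow0.
rewrite -(ge0_integralZl mu measurableT ms)//; last first.
  by move=> x _; rewrite lee_fin exprn_ge0.
rewrite -(ge0_integralZl P measurableT meq)//.
transitivity (\int[mu]_x \int[P]_w F (x, w))%E.
  by apply: eq_integral => x _; rewrite innerP.
rewrite FT; apply: eq_integral => w _; exact: innermu.
Qed.
End Average.
End RotationInvariant.
End GaussianAverage.

(** * Remaining constants, singular frames and the average formula *)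

Section Assembly.
Variable R : realType.
Local Notation gamma := (@normal_prob R 0 1).

(** Only finiteness and positivity are recorded, because this moment cancels later. They come from
    the chi-square law in dimension 1, as [|y|] is the square root of [y ^+ 2]. *)
Lemma normal_abs_moment (p : nat) :
  exists2 c : R, 0 < c & (\int[gamma]_y (`|y| ^+ p)%:E = c%:E)%E.
Proof.
have [d [T [P [N [_ LN /(_ isT) QN]]]]] := exists_standard_normal_vector R 1.
have := @chi2_law_moment R _ _ P _ 1 p isT QN.
have [G1 _] := Gamma_half_fin R (isT : (0 < 1)%N).
have [Gp _] := Gamma_half_fin R (isT : (0 < 1 + p)%N).
set c := (X in _ = X%:E) => E; exists c.
  have s2 : 0 < Num.sqrt 2 :> R by rewrite sqrtr_gt0.
  exact: mulr_gt0 (exprn_gt0 p s2) (divr_gt0 Gp G1).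
have mpow : measurable_fun [set: R] (fun x => (`|x| ^+ p)%:E).
  by apply/measurable_EFinP; apply: measurable_funX; exact: normr_measurable.
have pow0 (x : R) : (0 <= (`|x| ^+ p)%:E)%E by rewrite lee_fin exprn_ge0.
rewrite -E; have := LN (fun=> 1) _ mpow pow0; rewrite big_ord1 expr1n sqrtr1.
move=> LE; transitivity (\int[gamma]_x (`|1 * x| ^+ p)%:E)%E.
  by apply: eq_integral => x _; rewrite mul1r.
rewrite -[LHS]LE; apply: eq_integral => w _.
by rewrite !big_ord1 mul1r sqrtr_sqr.
Qed.

(** The expected squared norm of a standard normal vector is [m] by summing over coordinates and
    [2 * Gamma ((m + 2) / 2) / Gamma (m / 2)] by the chi-square law. *)
Lemma Gamma_half_add2 (m : nat) : (0 < m)%N ->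
  Gamma (m%:R / 2 : R) / Gamma ((m + 2)%:R / 2) = 2 / m%:R.
Proof.
move=> m0.
have [d [T [P [N [mN LN /(_ m0) QN]]]]] := exists_standard_normal_vector R m.
have := chi2_law_moment 2 m0 QN.
have [G1 _] := Gamma_half_fin R m0.
have [G2 _] := Gamma_half_fin R (ltn_addr 2 m0).
have N2 i : (\int[P]_w (N i w ^+ 2)%:E = 1)%E.
  have E := scaled_normal_sqr (LN (fun j => (j == i)%:R)).
  transitivity (\int[P]_w ((\sum_(j < m) (j == i)%:R * N j w) ^+ 2)%:E)%E.
    apply: eq_integral => w _; rewrite (bigD1 i)//= eqxx mul1r big1 ?addr0//.
    by move=> j /negbTE ->; rewrite mul0r.
  rewrite [LHS]E sqr_sqrtr; last by apply: sumr_ge0 => j _; exact: sqr_ge0.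
  rewrite (bigD1 i)//= eqxx expr1n big1 ?addr0// => j /negbTE ->.
  by rewrite expr0n.
have -> : (\int[P]_w (Num.sqrt (\sum_i N i w ^+ 2) ^+ 2)%:E =
    \int[P]_w (\sum_i (N i w ^+ 2)%:E))%E.
  apply: eq_integral => w _; rewrite sumEFin sqr_sqrtr//.
  by apply: sumr_ge0 => i _; exact: sqr_ge0.
rewrite ge0_integral_sum//; last 2 first.
- by move=> i; apply/measurable_EFinP; exact: measurable_funX.
- by move=> i w _; rewrite lee_fin sqr_ge0.
under eq_bigr do rewrite N2.
rewrite sumEFin sumr_const card_ord sqr_sqrtr// => -[mE].
rewrite [in RHS]mE; move: (Gamma _) (Gamma _) G1 G2 => u v u0 v0.
by field; rewrite !gt_eqF.
Qed.

Lemma gnorm_frame n (g B : 'M[R]_n) (v : 'rV[R]_n) : B *m g *m B^T = 1%:M ->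
  gnorm g v = Num.sqrt (sqnorm (v *m invmx B)).
Proof.
move=> BgB.
have Bu : B \in unitmx by have /mulmx1_unit[] : B *m (g *m B^T) = 1%:M by rewrite mulmxA.
have gE : g = invmx B *m (invmx B)^T.
  have := congr1 (fun A => invmx B *m A *m (invmx B)^T) BgB.
  by rewrite !mulmxA mulVmx// mul1mx mulmx1 -mulmxA -trmx_mul mulVmx// trmx1 mulmx1.
congr (Num.sqrt _); rewrite gE -!mulmxA -trmx_mul mulmxA mul_trmx_sqnorm.
by rewrite mxE eqxx.
Qed.

Section Singular.
Variables (k n : nat) (gX : 'M[R]_(1 + k)) (gY : 'M[R]_n) (M : 'M[R]_(1 + k, n)).
Variables (sigma : 'I_n -> R) (le_n : (n <= 1 + k)%N).
Let D : 'M[R]_(1 + k, n) := \matrix_(i < 1 + k, j < n) (if (i == j :> nat) then sigma j else 0).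

Lemma gnorm_singular (B : 'M[R]_(1 + k)) (C : 'M[R]_n) (v : 'rV[R]_(1 + k)) :
  B *m gX *m B^T = 1%:M -> C *m gY *m C^T = 1%:M -> B *m M = D *m C ->
  gnorm gY (v *m M) =
  Num.sqrt (\sum_(j < n) ((v *m invmx B) 0 (widen_ord le_n j) * sigma j) ^+ 2).
Proof.
move=> BgB CgC BM.
have Bu := mul_frame_unit BgB.
have Cu : C \in unitmx by have /mulmx1_unit[] : C *m (gY *m C^T) = 1%:M by rewrite mulmxA.
rewrite (gnorm_frame _ CgC); congr (Num.sqrt _).
have -> : v *m M *m invmx C = v *m invmx B *m D.
  by rewrite -{1}(mulmxKV Bu v) -(mulmxA _ B M) BM mulmxA mulmxK.
apply: eq_bigr => j _; congr (_ ^+ 2); rewrite mxE (bigD1 (widen_ord le_n j))//=.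
rewrite [D _ _]mxE eqxx big1 ?addr0// => i ij; rewrite [D _ _]mxE ifN ?mulr0//.
Qed.

(** Orthonormality of the rows of [B] means that the inverse of [gX] is [B^T *m B]. Cyclicity of the
    trace then brings the product to [D *m D^T]. *)
Lemma frobenius_singular : singular_values gX gY M sigma ->
  frobenius_norm gX gY M = Num.sqrt (\sum_(j < n) sigma j ^+ 2).
Proof.
move=> [_ [B [C [BgB CgC BM]]]].
have Bu := mul_frame_unit BgB.
congr (Num.sqrt _).
have gE : invmx gX = B^T *m B.
  have gBB : gX *m (B^T *m B) = 1%:M.
    by rewrite mulmxA; apply: mulmx1C; rewrite mulmxA.
  have [gu _] := mulmx1_unit gBB.
  by rewrite -[LHS]mulmx1 -gBB mulKmx.
rewrite gE !mulmxA mxtrace_mulC !mulmxA BM.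
have -> : D *m C *m gY *m M^T *m B^T = D *m D^T.
  by rewrite -mulmxA -trmx_mul BM trmx_mul !mulmxA -2!(mulmxA D) CgC mulmx1.
rewrite /mxtrace; under eq_bigr do rewrite mxE.
rewrite exchange_big; apply: eq_bigr => j _.
rewrite (bigD1 (widen_ord le_n j))//= !mxE eqxx -expr2 big1 ?addr0// => i ij.
rewrite !mxE ifN ?mul0r//.
Qed.
End Singular.

Section AverageFormula.
Variables (k n : nat) (gX : 'M[R]_(1 + k)) (gY : 'M[R]_n) (M : 'M[R]_(1 + k, n)).
Variables (sigma : 'I_n -> R) (le_n : (n <= 1 + k)%N).
Hypothesis hsigma : singular_values gX gY M sigma.
Variable dS : {measure set (borelV R (1 + k)) -> \bar R}.
Hypothesis hdS : induced_volume k gX (unit_sphere gX) dS.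

Lemma measurable_unit_sphere (B : 'M[R]_(1 + k)) : B *m gX *m B^T = 1%:M ->
  measurable (unit_sphere gX : set (borelV R (1 + k))).
Proof.
move=> BgB.
have msq : measurable_fun setT (@Num.sqrt R : R -> R).
  by apply: continuous_measurable_fun; exact: sqrt_continuous.
have mf := measurableT_comp msq
  (measurableT_comp (@measurable_sqnorm R (1 + k)) (measurable_mulmxr (invmx B))).
rewrite -[X in measurable X]setTI.
rewrite (_ : unit_sphere gX = (fun v : borelV R (1 + k) =>
    Num.sqrt (sqnorm (v *m invmx B))) @^-1` [set 1]).
  exact: mf (measurable_set1 (1 : R)).
by apply/seteqP; split => v /=; rewrite /unit_sphere/= (gnorm_frame v BgB).
Qed.

Lemma sphere_integral (B : 'M[R]_(1 + k)) (F : borelV R (1 + k) -> \bar R) :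
  B *m gX *m B^T = 1%:M -> measurable_fun setT F -> (forall v, 0 <= F v)%E ->
  (\int[dS]_(v in unit_sphere gX) F (v *m invmx B) =
   \int[frame_measure dS B]_x F x)%E.
Proof.
move=> BgB mF F0; have [dSC _] := hdS.
have mS := measurable_unit_sphere BgB.
have mFB : measurable_fun [set: borelV R (1 + k)] (fun v : borelV R (1 + k) => F (v *m invmx B)).
  exact: measurableT_comp mF (measurable_mulmxr (invmx B)).
rewrite /frame_measure (ge0_integral_image_measure dS (measurable_mulmxr (invmx B)) mF F0).
rewrite [RHS](ge0_negligible_integral (measurableC mS) measurableT mFB _ dSC).
  by rewrite setTD setCK.
by move=> v _; exact: F0.
Qed.

Lemma sphere_measure (B : 'M[R]_(1 + k)) : B *m gX *m B^T = 1%:M ->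
  dS (unit_sphere gX) = frame_measure dS B setT.
Proof.
move=> BgB; have [dSC _] := hdS.
have mS := measurable_unit_sphere BgB.
rewrite -[RHS]/(dS setT) -(setUv (unit_sphere gX)).
rewrite measureU//; [|exact: measurableC|by rewrite setICr].
by rewrite [X in (_ + X)%E](_ : _ = 0%E) ?adde0.
Qed.
Context d (T : measurableType d) (P : probability T R).
Variable eta : 'I_n -> {RV P >-> R}.
Hypothesis heta : centered_gaussian_diag eta sigma.

Lemma sphere_average (p : nat) :
  ((fine (dS (unit_sphere gX)))^-1%:E *
     \int[dS]_(v in unit_sphere gX) (gnorm gY (v *m M) ^+ p)%:E =
   ((Num.sqrt 2 ^+ p)^-1 *
    (Gamma ((1 + k)%:R / 2 : R) / Gamma ((1 + k + p)%:R / 2)))%:E *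
   \int[P]_w (enorm (fun i => eta i w) ^+ p)%:E)%E.
Proof.
have [_ [B [C [BgB CgC BM]]]] := hsigma.
pose nu := frame_measure dS B.
(* Restriction to the whole space changes no value; it equips [nu] with the structure of a finite
   measure. *)
pose mu : {finite_measure set (borelV R (1 + k)) -> \bar R} :=
  mfrestr measurableT (frame_measure_fin hdS BgB).
have muE A : mu A = nu A by rewrite /mu /= /mfrestr /mrestr setIT.
have imu (f : borelV R (1 + k) -> \bar R) : (\int[mu]_x f x = \int[nu]_x f x)%E.
  by apply: eq_measure_integral => A mA _; exact: muE.
have rot (Q : 'M[R]_(1 + k)) (f : borelV R (1 + k) -> \bar R) :
    Q *m Q^T = 1%:M -> measurable_fun setT f -> (forall x, 0 <= f x)%E ->
    (\int[mu]_x f x = \int[mu]_x f (x *m Q))%E.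
  move=> QQ mf f0; rewrite !imu; exact: (frame_measure_rotate hdS BgB QQ mf f0).
have mnorm l (h : (l <= 1 + k)%N) (b : 'I_l -> R) : measurable_fun [set: borelV R (1 + k)]
    (fun x : borelV R (1 + k) => (Num.sqrt (\sum_(j < l)
      ((x : 'rV[R]_(1 + k)) 0 (widen_ord h j) * b j) ^+ 2) ^+ p)%:E).
  apply/measurable_EFinP; apply: measurable_funX.
  apply: measurableT_comp; first by apply: continuous_measurable_fun; exact: sqrt_continuous.
  apply: measurable_sum => j; apply: measurable_funX; apply: measurable_funM => //.
  exact: measurable_coord.
have normE : (\int[dS]_(v in unit_sphere gX) (gnorm gY (v *m M) ^+ p)%:E =
    \int[mu]_x (Num.sqrt (\sum_(j < n)
      ((x : 'rV[R]_(1 + k)) 0 (widen_ord le_n j) * sigma j) ^+ 2) ^+ p)%:E)%E.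
  rewrite imu -(sphere_integral BgB (mnorm _ le_n sigma)); last first.
    by move=> v; rewrite lee_fin exprn_ge0// sqrtr_ge0.
  by apply: eq_integral => v _; rewrite (gnorm_singular le_n v BgB CgC BM).
have [s s0 sE] : exists2 s : R, 0 < s & nu setT = s%:E.
  have fin := frame_measure_fin hdS BgB; have pos := frame_measure_gt0 hdS BgB.
  exists (fine (nu setT)); first by rewrite fine_gt0// pos fin.
  by rewrite fineK// ge0_fin_numE.
have sphE : dS (unit_sphere gX) = s%:E by rewrite (sphere_measure BgB).
have [c c0 cE] := normal_abs_moment p.
have [d' [T' [P' [N [mN LN /(_ isT) QN]]]]] := exists_standard_normal_vector R (1 + k).
have LN1 b : scaled_normal P' (fun w => \sum_(i < 1 + k) b i * N i w)
    (Num.sqrt (\sum_(i < 1 + k) (b i * 1) ^+ 2)).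
  by under eq_bigr do rewrite mulr1; exact: LN.
have etaE := gaussian_sphere_average rot p le_n
  (fun i => measurable_funPT (eta i)) (gaussian_diag_scaled_normal heta).
set cmu := (\int[mu]_x (`|(x : 'rV[R]_(1 + k)) 0 0| ^+ p)%:E)%E in etaE *.
set K := Num.sqrt 2 ^+ p * (Gamma ((1 + k + p)%:R / 2) / Gamma ((1 + k)%:R / 2)) : R.
(* The average identity for a standard normal vector of the full dimension: all weights are 1, so
   the integrand on the sphere is 1 and its integral is the mass [s]. *)
have NE : (c%:E * s%:E = cmu * K%:E)%E.
  have KE := @chi2_law_moment R _ _ P' _ (1 + k) p (ltn0Sn k) QN.
  rewrite -cE -[in RHS]KE.
  rewrite -(gaussian_sphere_average rot p (leqnn (1 + k)) mN LN1); congr (_ * _)%E.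
  rewrite imu -(sphere_integral BgB (mnorm _ (leqnn (1 + k)) (fun=> 1))); last first.
    by move=> v; rewrite lee_fin exprn_ge0// sqrtr_ge0.
  have one v : unit_sphere gX v -> Num.sqrt (\sum_(j < 1 + k)
      ((v *m invmx B) 0 (widen_ord (leqnn (1 + k)) j) * 1) ^+ 2) ^+ p = 1.
    rewrite /unit_sphere/= (gnorm_frame v BgB) => Sv.
    transitivity (Num.sqrt (sqnorm (v *m invmx B)) ^+ p); last by rewrite Sv expr1n.
    congr (Num.sqrt _ ^+ _); apply: eq_bigr => j _; rewrite mulr1.
    by congr (_ ^+ 2); congr (_ 0 _); exact: val_inj.
  transitivity (\int[dS]_(v in unit_sphere gX) (1 : R)%:E)%E; last first.
    by apply: eq_integral => v /set_mem Sv; rewrite one.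
  by rewrite integral_cst ?mul1e//; exact: (measurable_unit_sphere BgB).
rewrite cE -normE in etaE.
have K0 : 0 < K.
  have [G1 _] := Gamma_half_fin R (ltn0Sn k).
  have [G2 _] := Gamma_half_fin R (ltn_addr p (ltn0Sn k)).
  have s2 : 0 < Num.sqrt 2 :> R by rewrite sqrtr_gt0.
  exact: mulr_gt0 (exprn_gt0 p s2) (divr_gt0 G2 G1).
(* As [K] is positive and [c * s] is a real number, an infinite [cmu] would contradict [NE]. *)
have cmuE : cmu = (c * s / K)%:E.
  move: NE; case: (cmu) => [r| |].
  - by rewrite -!EFinM => -[->]; rewrite mulfK// gt_eqF.
  - by rewrite gt0_mulye ?lte_fin.
  - by rewrite gt0_mulNye ?lte_fin.
rewrite sphE /=.
rewrite cmuE in etaE.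
(* Multiplying and dividing by [c] brings in the average identity for [eta]; with [cmu = c * s / K]
   both [c] and [s] drop out and [K^-1] remains. *)
transitivity ((s^-1 / c)%:E *
    (c%:E * \int[dS]_(v in unit_sphere gX) (gnorm gY (v *m M) ^+ p)%:E))%E.
  by rewrite muleA -EFinM divfK// gt_eqF.
rewrite etaE muleA -EFinM; congr (_%:E * _)%E.
transitivity K^-1; last by rewrite /K invfM invf_div.
move: (K) K0 => K' K'0.
by field; rewrite !gt_eqF.
Qed.
End AverageFormula.
End Assembly.

(** Stereographic coordinates split off one coordinate and need a dimension of the form [1 + k].
    Destructing [m] provides it and turns [m.-1] into [k]. *)
Lemma sphere_average_dim (R : realType) (m n : nat) (m_gt0 : (0 < m)%N)
    (le_nm : (n <= m)%N) (gX : 'M[R]_m) (gY : 'M[R]_n) (M : 'M[R]_(m, n))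
    (sigma : 'I_n -> R) (hsigma : singular_values gX gY M sigma)
    (dS : {measure set (borelV R m) -> \bar R})
    (hdS : induced_volume m.-1 gX (unit_sphere gX) dS)
    (d : measure_display) (T : measurableType d) (P : probability T R)
    (eta : 'I_n -> {RV P >-> R}) (heta : centered_gaussian_diag eta sigma) :
  frobenius_norm gX gY M = Num.sqrt (\sum_(j < n) sigma j ^+ 2) /\
  forall p : nat, ((fine (dS (unit_sphere gX)))^-1%:E *
     \int[dS]_(v in unit_sphere gX) (gnorm gY (v *m M) ^+ p)%:E =
   ((Num.sqrt 2 ^+ p)^-1 *
    (Gamma (m%:R / 2 : R) / Gamma ((m + p)%:R / 2)))%:E *
   \int[P]_w (enorm (fun i => eta i w) ^+ p)%:E)%E.
Proof.
case: m m_gt0 le_nm gX M dS hsigma hdS => // k _ le_n gX M dS hs hdS.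
split; first exact: (@frobenius_singular R k n gX gY M sigma le_n hs).
by move=> p; exact: (@sphere_average R k n gX gY M sigma le_n hs dS hdS d T P eta heta p).
Qed.

Theorem theorem1 (R : realType) (m n : nat) (m_gt0 : (0 < m)%N)
    (le_nm : (n <= m)%N)
    (X : riemannianManifold R m) (Y : riemannianManifold R n)
    (V : set (X * Y)) (hV : solution_variety V)
    (x : X) (y : Y) (hxy : V (x, y)) (hreg : ~ critical_point V (x, y))
    (G : X -> Y) (hG : local_solution_map V x y G)
    (a : chart R X m) (b : chart R Y n)
    (ha : ratlas a) (hb : ratlas b) (hax : cdom a x) (hby : cdom b y)
    (sigma : 'I_n -> R)
    (hsigma : singular_values (rmetric x a) (rmetric y b)
                (condition_matrix a b G x) sigma)
    (dS : {measure set (borelV R m) -> \bar R})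
    (hdS : induced_volume m.-1 (rmetric x a) (tangent_sphere a x) dS)
    (d : measure_display) (T : measurableType d) (P : probability T R)
    (eta : 'I_n -> {RV P >-> R})
    (heta : centered_gaussian_diag eta sigma) :
  (forall p : nat, (0 < p)%N ->
     kappa_av a b G x y dS p =
     (((Num.sqrt 2)^-1 *
       (Gamma (m%:R / 2 : R) / Gamma ((m + p)%:R / 2)) `^ (p%:R^-1))%:E *
      'E_P[fun w => (enorm (fun i => eta i w) ^+ p)%R] `^ (p%:R^-1))%E) /\
  kappa_av a b G x y dS 2 = (kappa_F a b G x y / Num.sqrt m%:R)%:E.
Proof.
have [frobE avg] := sphere_average_dim m_gt0 le_nm hsigma hdS heta.
rewrite /kappa_av /kappa_F frobE /tangent_sphere.
split=> [p p0|]; rewrite avg.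
  rewrite expectation.unlock.
  have c0 : 0 <= Gamma (m%:R / 2 : R) / Gamma ((m + p)%:R / 2).
    have [G1 _] := Gamma_half_fin R m_gt0.
    have [G2 _] := Gamma_half_fin R (ltn_addr p m_gt0).
    exact: ltW (divr_gt0 G1 G2).
  have s0 : 0 <= Num.sqrt 2 :> R by exact: sqrtr_ge0.
  have i0 : 0 <= (Num.sqrt 2 ^+ p)^-1 :> R by rewrite invr_ge0 exprn_ge0.
  rewrite poweRM; last 2 first.
  - by rewrite lee_fin mulr_ge0.
  - by apply: integral_ge0 => w _; rewrite lee_fin exprn_ge0// sqrtr_ge0.
  (* Since [p] is nonzero, the exponents [p] and [1 / p] cancel on the factor [1 / sqrt 2]. *)
  rewrite poweR_EFin (powRM _ i0 c0) -exprVn -powR_mulrn ?invr_ge0//.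
  by rewrite -powRrM mulfV ?powRr1 ?invr_ge0// pnatr_eq0 -lt0n.
have -> : (\int[P]_w (enorm (fun i => eta i w) ^+ 2)%:E = (\sum_i sigma i ^+ 2)%:E)%E.
  rewrite -(gaussian_diag_sqr_norm heta); apply: eq_integral => w _.
  by rewrite sqr_sqrtr// sumr_ge0// => i _; exact: sqr_ge0.
(* For [p = 2] the constant is [(1 / 2) * (2 / m) = 1 / m]. *)
rewrite (Gamma_half_add2 R m_gt0) sqr_sqrtr//.
have s0 : 0 <= \sum_i sigma i ^+ 2 by apply: sumr_ge0 => i _; exact: sqr_ge0.
rewrite mulKf ?pnatr_eq0// -EFinM poweR_EFin mulrC powR12_sqrt.
  by rewrite (sqrtrM _ s0) sqrtrV.
by rewrite divr_ge0.
Qed.
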